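(* For all $\varepsilon,\gamma>0$: (i) for the fraction $L_{E,n}$, $$\inf_{\varepsilon>0}C_{AB}^{E}(g_0,\varepsilon,\gamma)\ge\frac{1}{3\sqrt{2\pi}}\sup_{\frac12<p<1}\frac{p+1}{\max\{1-p,\ \gamma(1-p)^2+p^2,\ \gamma(2p-1)\}},$$ in particular $\inf_{\varepsilon>0}C_{AB}^{E}(g_0,\varepsilon,1)\ge\frac{\sqrt{10}+3}{6\sqrt{2\pi}}=0.4097\ldots$; (ii) for the fraction $L_{R,n}$, $$C_{AB}^{R}(g_0,\varepsilon,\gamma)\ge\begin{cases}\dfrac{1+\sqrt5}{3\sqrt{2\pi}\big(2\gamma\min\{\varepsilon^{-1},1\}(\sqrt5-2)+3-\sqrt5\big)},&\dfrac{\gamma}{\max\{\varepsilon,1\}}<\dfrac23,\\[3mm] \dfrac1{\sqrt{2\pi}}=0.3989\ldots,&\dfrac{\gamma}{\max\{\varepsilon,1\}}\ge\dfrac23;\end{cases}$$ (iii) $C_{AB}^{E}(g_1,\varepsilon,\gamma)=C_{AB}^{R}(g_1,\varepsilon,\gamma)=0$.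
   Context: $\Phi$ is the standard normal distribution function. Let $\mathcal F$ be the set of non-degenerate distribution functions with zero mean and finite second moment. For $F\in\mathcal F$ let $X_1,\dots,X_n$ be i.i.d. with distribution function $F$, $\sigma_1^2={\sf E}X_1^2$, $B_n^2=n\sigma_1^2$, $S_n=X_1+\dots+X_n$, $\Delta_n(F)=\sup_x|{\sf P}(S_n/B_n<x)-\Phi(x)|$, $\mu_1(z)={\sf E}X_1^3\mathbf 1(|X_1|<z)$, $\sigma_1^2(z)={\sf E}X_1^2\mathbf 1(|X_1|\ge z)$, $M_n(z)=nB_n^{-3}\mu_1(zB_n)$, $L_n(z)=nB_n^{-2}\sigma_1^2(zB_n)$. Let $\mathcal G$ be the set of non-decreasing $g:[0,\infty)\to[0,\infty)$ with $g(z)>0$ for $z>0$ and $z/g(z)$ non-decreasing on $(0,\infty)$. For $g\in\mathcal G$, $\varepsilon,\gamma>0$: $L_{E,n}(g,\varepsilon,\gamma)=\sup_{0<z<\varepsilon}\frac{g(zB_n)}{zg(B_n)}(\gamma|M_n(z)|+zL_n(z))$ and $L_{R,n}(g,\varepsilon,\gamma)=\gamma\frac{g(\varepsilon B_n)}{\varepsilon g(B_n)}|M_n(\varepsilon)|+\sup_{0<z<\varepsilon}\frac{g(zB_n)}{g(B_n)}L_n(z)$. Here $g_0(z)=\min\{z,B_n\}$ and $g_1(z)=\max\{z,B_n\}$. The asymptotically best constants are $C_{AB}^{E}(g,\varepsilon,\gamma)=\sup_{F\in\mathcal F}\limsup_{n\to\infty}\Delta_n(F)/L_{E,n}(g,\varepsilon,\gamma)$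 and $C_{AB}^{R}(g,\varepsilon,\gamma)=\sup_{F\in\mathcal F}\limsup_{n\to\infty}\Delta_n(F)/L_{R,n}(g,\varepsilon,\gamma)$ (the fractions computed for the distribution $F$). *)

(* Defs.v *)
From HB Require Import structures.
From mathcomp Require Import all_boot all_order all_algebra.
From mathcomp Require Import all_classical all_reals all_analysis.
Set Implicit Arguments. Unset Strict Implicit. Unset Printing Implicit Defensive.
Import Order.TTheory GRing.Theory Num.Def Num.Theory.
Local Open Scope classical_set_scope.
Local Open Scope ring_scope.

(* A distribution F on R is represented by its probability measure
   F : probability R R (the law of X_1). *)

Definition calF (R : realType) : set (probability R R) :=
  [set F : probability R R | (\int[F]_x ((x : R) ^+ 2)%:E < +oo)%E
         /\ (\int[F]_x (x : R)%:E = 0)%E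
         /\ ~ (exists a : R, F [set a] = 1%E)].

Definition sigma1sq (R : realType) (F : probability R R) : R :=
  fine (\int[F]_x (x ^+ 2)%:E).

Definition Bn (R : realType) (F : probability R R) (n : nat) : R :=
  Num.sqrt (n%:R * sigma1sq F).

(* Law of S_n = X_1 + ... + X_n for X_i i.i.d. with law F:
   the n-fold convolution power of F, P(S_0 in A) = 1(0 in A),
   P(S_{n+1} in A) = \int P(S_n + y in A) dF(y). *)
Fixpoint lawS (R : realType) (F : probability R R) (n : nat) : set R -> \bar R :=
  match n with
  | 0 => fun A => \d_(0 : R) A
  | m.+1 => fun A => (\int[F]_y lawS F m [set z : R | A (z + y)%R])%E
  end.

Definition Phi (R : realType) (x : R) : R :=
  fine (normal_prob 0 1 `]-oo, x[).

Definition Delta (R : realType) (F : probability R R) (n : nat) : R :=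
  sup (range (fun x : R =>
    `| fine (lawS F n [set s | s / Bn F n < x]) - Phi x |)).

Definition mu1 (R : realType) (F : probability R R) (z : R) : R :=
  fine (\int[F]_(x in [set x : R | `|x| < z]) (x ^+ 3)%:E).

Definition sigma1sqz (R : realType) (F : probability R R) (z : R) : R :=
  fine (\int[F]_(x in [set x : R | z <= `|x|]) (x ^+ 2)%:E).

Definition Mn (R : realType) (F : probability R R) (n : nat) (z : R) : R :=
  n%:R * (Bn F n) ^- 3 * mu1 F (z * Bn F n).

Definition Ln (R : realType) (F : probability R R) (n : nat) (z : R) : R :=
  n%:R * (Bn F n) ^- 2 * sigma1sqz F (z * Bn F n).

(* The functions g may depend on B_n (as g_0, g_1 do): g B z. *)
Definition g0 (R : realType) (B z : R) : R := Num.min z B.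
Definition g1 (R : realType) (B z : R) : R := Num.max z B.

Definition LE (R : realType) (F : probability R R) (g : R -> R -> R)
    (eps gam : R) (n : nat) : R :=
  let B := Bn F n in
  sup [set g B (z * B) / (z * g B B) * (gam * `|Mn F n z| + z * Ln F n z)
      | z in `]0, eps[].

Definition LR (R : realType) (F : probability R R) (g : R -> R -> R)
    (eps gam : R) (n : nat) : R :=
  let B := Bn F n in
  gam * (g B (eps * B) / (eps * g B B)) * `|Mn F n eps|
  + sup [set g B (z * B) / g B B * Ln F n z | z in `]0, eps[].

Definition CAB_E (R : realType) (g : R -> R -> R) (eps gam : R) : \bar R :=
  ereal_sup [set limn_esup (fun n => (Delta F n / LE F g eps gam n)%:E)
            | F in @calF R].

Definition CAB_R (R : realType) (g : R -> R -> R) (eps gam : R) : \bar R :=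
  ereal_sup [set limn_esup (fun n => (Delta F n / LR F g eps gam n)%:E)
            | F in @calF R].

(* Main.v *)
Require Import Defs.
From HB Require Import structures.
From mathcomp Require Import all_boot all_order all_algebra.
From mathcomp Require Import all_classical all_reals all_analysis.
From mathcomp Require Import measurable_realfun ring lra.
Import Order.TTheory GRing.Theory Num.Def Num.Theory.
Import numFieldNormedType.Exports.
Local Open Scope classical_set_scope.
Local Open Scope ring_scope.
Set Implicit Arguments. Unset Strict Implicit. Unset Printing Implicit Defensive.

(** The lower bounds (i) and (ii) come from the two-point laws taking the value
    1-p with probability p and -p with probability 1-p, along the n for which
    n p is an integer: there 1/2 - P(S_n < 0) is asymptotically
    (1+p) / (3 sqrt(2 pi) B_n), the sum of the lattice and the skewness terms of
    Esseen's expansion, whereas both fractions are explicit multiples of 1/B_n.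
    The rational p suffice, by continuity of the resulting bound in p.

    The asymptotics are obtained by Stein's method.  Stein's equation for the
    sign function has the solution - M(|x|), M being the Mills ratio; inserting
    it in the exact difference identity satisfied by the two-point sums leaves
    E sign(S_n/B_n) = E k(S_n/B_n) / B_n + O(1/B_n^2) for an explicit Lipschitz
    function k, and the central limit theorem evaluates E k(S_n/B_n).

    The same method gives the central limit theorem, uniformly over bounded
    Lipschitz test functions and under a second moment only.  For g_1 both
    fractions are at least 1/2, so (iii) follows from Delta_n(F) -> 0. *)

(** * Gaussian tails and the Mills ratio *)

Section gaussian_tail.
Context {R : realType}.
Notation mu := (@lebesgue_measure R).
Implicit Types (x y : R) (w : R -> R).

(** For integral [n p] the origin is a lattice point of [S_n], and the sign taken as 1 at 0 has mean
    [1 - 2 P(S_n < 0)]. Half of this mean should be (1/2 + (2p-1)/6) / (sqrt(2 pi) B_n), half a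
    lattice span plus the skewness term, whence the factor (1+p)/3. The obstacle is the jump of the
    sign: bounds for Lipschitz test functions do not reach it at the precision 1/B_n. Two facts
    remove it. The difference identity of two-point sums is exact, so no error arises before the
    Stein solution is expanded; and the only singularity of that solution is a kink at 0, which no
    lattice step crosses. With step h = 1/B_n and f the solution, the difference quotient
    contributes -(h/2) f'' and the weight p of the identity contributes p h x f'; together they form
    h k. Since k is bounded and Lipschitz and already carries the factor h, the central limit
    theorem is needed for it without any rate. *)

Definition gauss x : R := expR (- (x ^+ 2 / 2)).

Lemma gauss_gt0 x : 0 < gauss x. Proof. exact: expR_gt0. Qed.

Lemma gauss_ge0 x : 0 <= gauss x. Proof. exact: expR_ge0. Qed.

Lemma gauss_neq0 x : gauss x != 0. Proof. by rewrite gt_eqF ?gauss_gt0. Qed.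

Lemma gauss_le1 x : gauss x <= 1.
Proof. by rewrite -expR0 ler_expR oppr_le0 divr_ge0 ?sqr_ge0. Qed.

Lemma gaussN x : gauss (- x) = gauss x. Proof. by rewrite /gauss sqrrN. Qed.

Lemma is_derive_gauss x : is_derive x 1 gauss (- x * gauss x).
Proof.
have h : is_derive x 1 (fun x : R => - (x ^+ 2 / 2)) (- x).
  by apply: is_derive_eq; rewrite /GRing.scale/=; field.
rewrite mulrC; exact: (@is_derive1_comp _ expR _ x _ _ (is_derive_expR _) h).
Qed.

Lemma continuous_gauss : continuous gauss.
Proof.
move=> x; apply: differentiable_continuous; apply/derivable1_diffP.
by case: (is_derive_gauss x).
Qed.

Lemma measurable_gauss : measurable_fun setT gauss.
Proof.
exact: continuous_measurable_fun continuous_gauss.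
Qed.

(** Square of [t <= expR t] at t = x^2/4. This polynomial decay is all that the limits at infinity
    below require. *)
Lemma expr4_gauss_le x : x ^+ 4 * gauss x <= 16.
Proof.
have e2 : gauss x * (expR (x ^+ 2 / 4) * expR (x ^+ 2 / 4)) = 1.
  by rewrite /gauss -!expRD -[RHS]expR0; congr expR; field.
have e1 : x ^+ 2 / 4 <= expR (x ^+ 2 / 4).
  by rewrite (le_trans _ (expR_ge1Dx _))// lerDr.
have /(ler_wpM2l (gauss_ge0 x)) :
    (x ^+ 2 / 4) * (x ^+ 2 / 4) <= expR (x ^+ 2 / 4) * expR (x ^+ 2 / 4).
  by apply: ler_pM => //; rewrite divr_ge0 ?sqr_ge0.
by rewrite e2; lra.
Qed.

Lemma normal_pdf01 x : normal_pdf 0 1 x = (Num.sqrt (2 * pi))^-1 * gauss x.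
Proof.
rewrite normal_pdfE ?oner_neq0// /normal_peak /normal_fun /gauss expr1n mul1r subr0.
by rewrite mulr_natl; congr (_ * expR _); rewrite mulNr.
Qed.

Lemma sqrt2pi_gt0 : 0 < Num.sqrt (2 * pi) :> R.
Proof. by rewrite sqrtr_gt0 mulr_gt0// pi_gt0. Qed.

Definition bdd_by (A : R) w := forall x, `|w x| <= A.

Lemma integrable_gauss w A D : measurable D ->
  measurable_fun setT w -> bdd_by A w ->
  mu.-integrable D (EFin \o (fun u => w u * gauss u)).
Proof.
move=> mD mw bw.
apply: (@integrableS _ _ _ mu setT) => //.
apply: (@le_integrable _ _ _ mu _ measurableT _
  (fun u => (A * Num.sqrt (2 * pi))%:E * (normal_pdf 0 1 u)%:E)%E) => //.
- by apply/measurable_EFinP; apply: measurable_funM => //; exact: measurable_gauss.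
- move=> x _ /=; rewrite normal_pdf01 !lee_fin.
  rewrite mulrA mulfK ?gt_eqF ?sqrt2pi_gt0//.
  rewrite !normrM (ger0_norm (gauss_ge0 _)) ler_wpM2r ?gauss_ge0//.
  by rewrite (le_trans (bw x))// ler_norm.
- by apply: integrableZl => //; exact: integrable_normal_pdf.
Qed.

Lemma is_derive_continuous (f : R -> R) x d : is_derive x 1 f d ->
    {for x, continuous f}.
Proof.
by move=> [df _]; apply: differentiable_continuous; apply/derivable1_diffP.
Qed.

Lemma dist_le_is_derive (f df : R -> R) C x y : x <= y ->
  (forall z, x <= z <= y -> is_derive z 1 f (df z)) ->
  (forall z, x <= z <= y -> `|df z| <= C) -> `|f y - f x| <= C * (y - x).
Proof.
move=> xy fd dC.
have [||c] := @MVT_segment R f df x y xy.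
- by move=> z; rewrite in_itv/= => /andP[xz zy]; apply: fd; rewrite !ltW.
- apply: continuous_in_subspaceT => z; rewrite inE/= in_itv/= => zxy.
  exact: is_derive_continuous (fd z zxy).
rewrite in_itv/= => cxy ->; rewrite normrM (ger0_norm (_ : 0 <= y - x)) ?subr_ge0//.
by rewrite ler_wpM2r ?subr_ge0// dC.
Qed.

Lemma nincr_is_derive (f df : R -> R) x y : x <= y ->
  (forall z, x <= z <= y -> is_derive z 1 f (df z)) ->
  (forall z, x <= z <= y -> df z <= 0) -> f y <= f x.
Proof.
move=> xy fd dC.
have [||c] := @MVT_segment R f df x y xy.
- by move=> z; rewrite in_itv/= => /andP[xz zy]; apply: fd; rewrite !ltW.
- apply: continuous_in_subspaceT => z; rewrite inE/= in_itv/= => zxy.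
  exact: is_derive_continuous (fd z zxy).
rewrite in_itv/= => cxy fE; rewrite -subr_le0 fE mulr_le0_ge0 ?subr_ge0//.
exact: dC.
Qed.

Definition itail w x : R := \int[mu]_(u in `[x, +oo[) (w u * gauss u).

(** The complement form moves the variable to an upper endpoint, where the fundamental theorem of
    calculus gives the derivative. *)
Lemma itailE w A x : continuous w -> bdd_by A w ->
  itail w x = \int[mu]_u (w u * gauss u) - \int[mu]_(u in `]-oo, x]) (w u * gauss
      u).
Proof.
move=> cw bw.
have mw := continuous_measurable_fun cw.
rewrite /itail -Rintegral_itv_obnd_cbnd; last exact: integrable_gauss bw.
rewrite -(@Rintegral_itvB _ _ -oo%O +oo%O x)//; last exact: integrable_gauss bw.
by rewrite set_itvNyy.
Qed.

Lemma is_derive_itail w A x : continuous w -> bdd_by A w ->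
  is_derive x 1 (itail w) (- (w x * gauss x)).
Proof.
move=> cw bw; have mw := continuous_measurable_fun cw.
have -> : itail w = (fun x => \int[mu]_u (w u * gauss u) - \int[mu]_(u in `]-oo,
    x]) (w u * gauss u)).
  by apply/funext => y; exact: itailE bw.
have [] := @continuous_FTC1 R (fun u => w u * gauss u) -oo%O x (x + 1).
- by rewrite ltrDl.
- exact: integrable_gauss bw.
- by rewrite ltNyr.
- by apply: continuousM; [exact: cw|exact: continuous_gauss].
move=> d1 d2.
have h : is_derive x 1 (fun y => \int[mu]_(t in `]-oo, y]) (w t * gauss t)) (w x
    * gauss x).
  by apply: DeriveDef => //; rewrite -derive1E.
by have := is_deriveB (is_derive_cst (\int[mu]_u (w u * gauss u)) x 1) h;
    rewrite sub0r.
Qed.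

Definition gauss_tail := itail (fun=> 1).

Lemma bdd_cst1 : bdd_by 1 (fun=> 1). Proof. by move=> x; rewrite normr1. Qed.

Lemma cst1_continuous : continuous (fun _ : R => 1 : R). Proof. by move=> x;
    exact: cvg_cst. Qed.

Lemma is_derive_gauss_tail x : is_derive x 1 gauss_tail (- gauss x).
Proof.
by have := is_derive_itail x cst1_continuous bdd_cst1; rewrite mul1r.
Qed.

Lemma gauss_tail_ge0 x : 0 <= gauss_tail x.
Proof. by apply: Rintegral_ge0 => u _; rewrite mul1r gauss_ge0. Qed.

Lemma cvg_gauss : gauss x @[x --> +oo] --> (0 : R).
Proof.
apply/cvgrPdist_le => e e0; near=> x.
have x1 : 1 <= x by near: x; exact: nbhs_pinfty_ge.
have xe : 16 / e <= x by near: x; apply: nbhs_pinfty_ge; exact: num_real.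
rewrite sub0r normrN ger0_norm ?gauss_ge0//.
have /(ler_wpM2r (gauss_ge0 x)) h : x <= x ^+ 4 by rewrite -[leLHS]expr1 ler_weXn2l.
rewrite -(@ler_pM2l _ x); last lra.
rewrite (le_trans h)// (le_trans (expr4_gauss_le x))//.
by rewrite -ler_pdivrMr.
Unshelve. all: by end_near. Qed.

Lemma integral_id_gauss x : 0 <= x ->
    (\int[mu]_(u in `[x, +oo[) (u * gauss u)%:E = (gauss x)%:E)%E.
Proof.
move=> x0; rewrite (@ge0_continuous_FTC2y _ _ (fun u => - gauss u) _ 0).
- by rewrite -EFinB sub0r opprK.
- by move=> u xu; rewrite mulr_ge0 ?gauss_ge0// (le_trans x0).
- apply: continuous_subspaceT => u; apply: continuousM;
    [exact: cvg_id|exact: continuous_gauss].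
- by rewrite -oppr0; apply: cvgN; exact: cvg_gauss.
- by move=> u _; case: (is_deriveN (is_derive_gauss u)).
- by apply: cvgN; apply: cvg_at_right_filter; exact: continuous_gauss.
- move=> u _; rewrite derive1E; have [_ ->] := is_deriveN (is_derive_gauss u).
  by rewrite mulNr opprK.
Qed.

Lemma Rintegral_id_gauss x : 0 <= x ->
    \int[mu]_(u in `[x, +oo[) (u * gauss u) = gauss x.
Proof. by move=> x0; rewrite /Rintegral integral_id_gauss. Qed.

Lemma integrable_id_gauss x : 0 <= x ->
    mu.-integrable `[x, +oo[ (EFin \o (fun u => u * gauss u)).
Proof.
move=> x0; apply/integrableP; split.
  apply/measurable_EFinP; apply: measurable_funTS; apply: measurable_funM => //.
  exact: measurable_gauss.
rewrite [ltLHS](_ : _ = (gauss x)%:E) ?ltry// -integral_id_gauss//.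
apply: eq_integral => u; rewrite inE/= in_itv/= andbT => xu.
by rewrite ger0_norm// mulr_ge0 ?gauss_ge0// (le_trans x0).
Qed.

Lemma integrable_gauss1 D : measurable D ->
    mu.-integrable D (EFin \o (fun u => 1 * gauss u)).
Proof. by move=> mD; apply: (integrable_gauss mD _ bdd_cst1). Qed.

(** Used twice: its positivity is the upper Mills inequality, and it measures the effect of a
    Lipschitz perturbation in [stein_bounds_ge0]. *)
Lemma Rintegral_shift_gauss x : 0 <= x ->
  \int[mu]_(u in `[x, +oo[) ((u - x) * gauss u) = gauss x - x * gauss_tail x.
Proof.
move=> x0; rewrite -Rintegral_id_gauss// /gauss_tail /itail -RintegralZl//;
    last exact: integrable_gauss1.
rewrite -RintegralB//; first last.
- have -> : (fun u => x * (1 * gauss u)) = (fun u => x * gauss u).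
    by apply/funext => u; rewrite mul1r.
  by apply: (@integrable_gauss (fun=> x) `|x|) => // ?.
- exact: integrable_id_gauss.
by apply: eq_Rintegral => u _; rewrite mul1r mulrBl.
Qed.

Lemma mul_gauss_tail_le x : 0 <= x -> x * gauss_tail x <= gauss x.
Proof.
move=> x0; rewrite -subr_ge0 -Rintegral_shift_gauss//; apply: Rintegral_ge0 => u /=.
by rewrite in_itv/= andbT => xu; rewrite mulr_ge0 ?gauss_ge0 ?subr_ge0.
Qed.

(** The difference [D] of the tail and x gauss(x)/(1+x^2) has derivative -2 gauss(x)/(1+x^2)^2, so
    it decreases. A negative value would therefore persist up to infinity, whereas [D] is eventually
    at least [- gauss], which tends to 0. *)
Lemma gauss_tail_ge x : 0 <= x -> x * gauss x <= (1 + x ^+ 2) * gauss_tail x.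
Proof.
move=> x0.
have p z : 0 < 1 + z ^+ 2 :> R by rewrite ltr_wpDr ?sqr_ge0.
pose D y := gauss_tail y - y * gauss y / (1 + y ^+ 2).
suff : 0 <= D x by rewrite subr_ge0 ler_pdivrMr// mulrC [X in _ <= X]mulrC.
have dD (z : R) : is_derive z 1 D (- (2 * gauss z / (1 + z ^+ 2) ^+ 2)).
  have h1 := is_derive_gauss_tail z; have h2 := is_derive_gauss z.
  have h3 : is_derive z 1 (fun y =>
      (1 + y ^+ 2)^-1) (- (1 + z ^+ 2) ^- 2 * (2 * z)).
    have h4 : is_derive z 1 (fun y : R => 1 + y ^+ 2) (2 * z).
      by apply: is_derive_eq; rewrite /GRing.scale/=; ring.
    have := @is_deriveV R (fun y : R => 1 + y ^+ 2) z _ 1 _ h4.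
    by apply; rewrite gt_eqF.
  apply: is_derive_eq; rewrite /GRing.scale/=; field.
  by rewrite gt_eqF.
have Dx y : x <= y -> D y <= D x.
  move=> xy; apply: (nincr_is_derive xy (fun z _ => dD z)) => z _.
  by rewrite oppr_le0 mulr_ge0 ?invr_ge0 ?sqr_ge0// mulr_ge0 ?gauss_ge0.
have Dge y : 1 <= y -> - gauss y <= D y.
  move=> y1; rewrite /D lerBrDr.
  apply: le_trans (gauss_tail_ge0 y);
      rewrite addrC subr_le0 ler_pdivrMr// mulrC ler_wpM2l ?gauss_ge0//.
  by nra.
rewrite leNgt; apply/negP => Dx0.
have : \forall y \near +oo, gauss y < - D x.
  have := cvg_gauss => /cvgrPdist_lt/(_ (- D x)); rewrite oppr_gt0 => /(_ Dx0).
  by apply: filterS => y; rewrite sub0r normrN ger0_norm ?gauss_ge0.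
move=> gsD; near (pinfty_nbhs R) => y.
have y1 : 1 <= y by near: y; exact: nbhs_pinfty_ge.
have xy : x <= y by near: y; apply: nbhs_pinfty_ge; exact: num_real.
have := Dx y xy; have := Dge y y1.
have : gauss y < - D x by near: y.
lra.
Unshelve. all: by end_near. Qed.

(** A crude bound: the integrand is at most 1 on [0, 1], and the tail beyond 1 is at most
    [gauss 1 <= 1]. *)
Lemma gauss_tail0_le2 : gauss_tail 0 <= 2.
Proof.
have : `|gauss_tail 1 - gauss_tail 0| <= 1 * (1 - 0).
  apply: (@dist_le_is_derive gauss_tail (fun z => - gauss z)) => // z _;
      first exact: is_derive_gauss_tail.
  by rewrite normrN ger0_norm ?gauss_ge0 ?gauss_le1.
have := @mul_gauss_tail_le 1 ler01; have := gauss_le1 1; rewrite ler_norml; lra.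
Qed.

Definition mills x := gauss_tail x / gauss x.

Lemma is_derive_gaussV x : is_derive x 1 (fun y => (gauss y)^-1) (x / gauss x).
Proof.
have := @is_deriveV R gauss x _ 1 (gauss_neq0 x) (is_derive_gauss x).
rewrite /GRing.scale/=.
set a := (X in is_derive _ _ _ X); have -> // : a = x / gauss x.
by rewrite /a; field; rewrite gauss_neq0.
Qed.

Lemma is_derive_mills x : is_derive x 1 mills (x * mills x - 1).
Proof.
have h1 := is_derive_gauss_tail x; have h2 := is_derive_gaussV x.
rewrite /mills; apply: is_derive_eq; rewrite /GRing.scale/=; field;
    exact: gauss_neq0.
Qed.

Lemma mills_ge0 x : 0 <= mills x. Proof.
    by rewrite divr_ge0 ?gauss_tail_ge0 ?gauss_ge0. Qed.

Lemma mul_mills_le1 x : 0 <= x -> x * mills x <= 1.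
Proof. by move=> x0; rewrite mulrA ler_pdivrMr ?gauss_gt0//
    mul1r mul_gauss_tail_le. Qed.

Lemma mills_ge x : 0 <= x -> x <= (1 + x ^+ 2) * mills x.
Proof. by move=> x0; rewrite mulrA ler_pdivlMr ?gauss_gt0// gauss_tail_ge. Qed.

Lemma mills_le2 x : 0 <= x -> mills x <= 2.
Proof.
move=> x0; have : mills x <= mills 0.
  apply: (nincr_is_derive x0 (fun z _ => is_derive_mills z)) => z /andP[z0 _].
  by rewrite subr_le0 mul_mills_le1.
have -> : mills 0 = gauss_tail 0
    by rewrite /mills /gauss expr0n/= mul0r oppr0 expR0 divr1.
by move=> /le_trans; apply; exact: gauss_tail0_le2.
Qed.

(** The decay 1 - x M(x) = O(1/x^2), obtained from the lower Mills inequality multiplied by x. It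
    keeps x f'(x) bounded for Stein solutions f. *)
Lemma onem_mul_mills_le x : 0 <= x -> (1 + x ^+ 2) * (1 - x * mills x) <= 1.
Proof.
move=> x0; have := ler_wpM2l x0 (mills_ge x0); have := mul_mills_le1 x0; nra.
Qed.

End gaussian_tail.

(** * Bounds for the solutions of Stein's equation *)

Section stein_solution.
Context {R : realType}.
Notation mu := (@lebesgue_measure R).
Implicit Types (x y : R) (w : R -> R).

Definition lip_by (K : R) w := forall x y, `|w x - w y| <= K * `|x - y|.

Lemma lip_continuous K w : lip_by K w -> continuous w.
Proof.
move=> lw x; apply/cvgrPdist_le => e e0.
have K0 : 0 <= K.
  by have := le_trans (normr_ge0 _) (lw 1 0); rewrite subr0 normr1 mulr1.
have K1 : 0 < K + 1 by rewrite ltr_wpDl.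
near=> y; rewrite (le_trans (lw x y))//.
have : `|x - y| <= e / (K + 1).
  near: y; move: (e / (K + 1)) (divr_gt0 e0 K1).
  by apply/cvgrPdist_le; exact: cvg_id.
rewrite ler_pdivlMr// => h; rewrite (le_trans _ h)// mulrC ler_wpM2l//.
by rewrite lerDl.
Unshelve. all: by end_near. Qed.

Lemma lip_opp K w : lip_by K w -> lip_by K (w \o -%R).
Proof. by move=> lw x y /=; rewrite (le_trans (lw _ _))// -opprD normrN. Qed.

Lemma bdd_opp A w : bdd_by A w -> bdd_by A (w \o -%R).
Proof. by move=> bw x /=. Qed.

Lemma bdd_ge0 A w : bdd_by A w -> 0 <= A.
Proof. by move=> bw; exact: le_trans (normr_ge0 _) (bw 0). Qed.

Lemma Rintegral_cstM_gauss (D : set (measurableTypeR R)) (c : R) : measurable D ->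
  \int[mu]_(u in D) (c * gauss u) = c * \int[mu]_(u in D) (1 * gauss u).
Proof.
move=> mD; rewrite -RintegralZl//; last exact: integrable_gauss1.
by apply: eq_Rintegral => u _; rewrite mul1r.
Qed.

Lemma itail_le w A x : continuous w -> bdd_by A w ->
    `|itail w x| <= A * gauss_tail x.
Proof.
move=> cw bw; have mw := continuous_measurable_fun cw.
rewrite /gauss_tail /itail -Rintegral_cstM_gauss//.
rewrite (le_trans (le_normr_Rintegral _ _))//; first exact: integrable_gauss bw.
apply: le_Rintegral => //.
- have := integrable_norm (integrable_gauss (measurable_itv `[x, +oo[) mw bw).
  by apply: eq_integrable.
- by apply: (@integrable_gauss _ (fun=> A) `|A|) => // ?.
- by move=> u _; rewrite normrM (ger0_norm (gauss_ge0 _)) ler_wpM2r ?gauss_ge0.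
Qed.

Lemma itail_refl w A x : continuous w -> bdd_by A w ->
  \int[mu]_(u in `]-oo, (- x)]) (w u * gauss u) = itail (w \o -%R) x.
Proof.
move=> cw bw; have mw := continuous_measurable_fun cw.
have cwN : continuous (w \o -%R).
  by move=> z; apply: continuous_comp; [exact: opp_continuous|exact: cw].
have mwN := continuous_measurable_fun cwN.
have A0 := bdd_ge0 bw.
(* The substitution u -> -u is made for nonnegative integrands; it is applied to [w + A] and to the
   constant [A], and the results are subtracted. *)
have key (v : R -> R) : continuous v -> (forall z, 0 <= v z) ->
    \int[mu]_(u in `]-oo, (- x)]) (v u * gauss u) =
        \int[mu]_(u in `[x, +oo[) ((v \o -%R) u * gauss u).
  move=> cv v0; rewrite /Rintegral; congr fine.
  rewrite ge0_integration_by_substitutionNy//.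
  - by apply: eq_integral => u _ /=; rewrite gaussN.
  - apply: continuous_subspaceT => u.
    by apply: continuousM; [exact: cv|exact: continuous_gauss].
  - by move=> u _; rewrite mulr_ge0 ?gauss_ge0.
have iA (D : set (measurableTypeR R)) : measurable D ->
    mu.-integrable D (EFin \o (fun u => A * gauss u)).
  by move=> mD; apply: (@integrable_gauss _ (fun=> A) `|A|) => // ?.
have split_ (v : R -> R) (D : set (measurableTypeR R)) : measurable D ->
    measurable_fun setT v -> bdd_by A v ->
    \int[mu]_(u in D) ((v u + A) * gauss u) =
    \int[mu]_(u in D) (v u * gauss u) + \int[mu]_(u in D) (A * gauss u).
  move=> mD mv bv; rewrite -RintegralD//; [|exact: integrable_gauss bv|exact: iA].
  by apply: eq_Rintegral => u _; rewrite mulrDl.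
have h1 := key (fun u => w u + A).
have h2 := key (fun=> A).
have {h1} h1 : \int[mu]_(u in `]-oo, (- x)]) ((w u + A) * gauss u) =
    \int[mu]_(u in `[x, +oo[) (((w \o -%R) u + A) * gauss u).
  apply: h1 => [z|z]; first by apply: continuousD; [exact: cw|exact: cvg_cst].
  by have := bw z; rewrite ler_norml => /andP[? _]; rewrite -lerBlDr sub0r.
have {}h2 : \int[mu]_(u in `]-oo, (- x)]) (A * gauss u) =
    \int[mu]_(u in `[x, +oo[) (A * gauss u).
  by apply: h2 => // z; exact: cvg_cst.
move: h1; rewrite !split_//; last exact: bdd_opp.
by rewrite h2 => /addIr.
Qed.

Lemma itailN w A x : continuous w -> bdd_by A w -> \int[mu]_u (w u * gauss u) = 0 ->
  itail w (- x) = - itail (w \o -%R) x.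
Proof. by move=> cw bw w0; rewrite (itailE _ cw bw) w0 (itail_refl _ cw bw)
    sub0r. Qed.

(** The solution of f' = x f + w that stays bounded at +oo for bounded [w]. If [w] has Gaussian mean
    zero, the integral over the other half-line gives the same function up to sign, so that it is
    bounded at -oo as well. *)
Definition stein w x := - itail w x / gauss x.

Lemma is_derive_stein w A x : continuous w -> bdd_by A w ->
  is_derive x 1 (stein w) (x * stein w x + w x).
Proof.
move=> cw bw; have h1 := is_derive_itail x cw bw; have h2 := is_derive_gaussV x.
rewrite /stein; apply: is_derive_eq; rewrite /GRing.scale/=; field;
    exact: gauss_neq0.
Qed.

Lemma steinN w A x : continuous w -> bdd_by A w -> \int[mu]_u (w u * gauss u) = 0 ->
  stein w (- x) = - stein (w \o -%R) x.
Proof. by move=> cw bw w0; rewrite /stein (itailN _ cw bw w0) gaussN opprK mulNr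
    opprK. Qed.

Lemma itail_split w A x : continuous w -> bdd_by A w ->
  itail w x = \int[mu]_(u in `[x, +oo[) ((w u - w x) * gauss u) + w x *
      gauss_tail x.
Proof.
move=> cw bw; have mw := continuous_measurable_fun cw.
rewrite /gauss_tail /itail -Rintegral_cstM_gauss// -RintegralD//.
- by apply: eq_Rintegral => u _; rewrite mulrBl subrK.
- apply: (@integrable_gauss _ (fun u => w u - w x) (A + A)) => //.
    exact: measurable_funB.
  by move=> u; rewrite (le_trans (ler_normB _ _))// lerD.
- by apply: (@integrable_gauss _ (fun=> w x) `|w x|) => // ?.
Qed.

(** The first two bounds compare [w] with the constant [A]. For the third, w(u) is split as w(x) +
    (w(u) - w(x)): the constant part contributes w(x) x (1 - x M(x)), the Lipschitz part at most K
    x^2 (1 - x M(x)), and both are controlled by (1 + x^2)(1 - x M(x)) <= 1. *)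
Lemma stein_bounds_ge0 w A K x : bdd_by A w -> lip_by K w -> 0 <= x ->
  [/\ `|stein w x| <= 2 * A, `|x * stein w x| <= A &
      `|x * (x * stein w x + w x)| <= A + K].
Proof.
move=> bw lw x0; have cw := lip_continuous lw.
have mw := continuous_measurable_fun cw.
have A0 := bdd_ge0 bw.
have K0 : 0 <= K.
  by have := le_trans (normr_ge0 _) (lw 1 0); rewrite subr0 normr1 mulr1.
have sM : `|stein w x| <= A * mills x.
  rewrite /stein normrM normrN normfV (ger0_norm (gauss_ge0 _)) mulrA.
  by rewrite ler_wpM2r ?invr_ge0 ?gauss_ge0// (itail_le _ cw bw).
have mills2 := mills_le2 x0; have mills1 := mul_mills_le1 x0;
    have M0 := mills_ge0 x.
split.
- by rewrite (le_trans sM)// mulrC ler_wpM2r.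
- rewrite normrM (ger0_norm x0) (le_trans (ler_wpM2l x0 sM))//.
  by rewrite mulrCA -[leRHS]mulr1 ler_wpM2l.
have sq := onem_mul_mills_le x0.
pose J := \int[mu]_(u in `[x, +oo[) ((w u - w x) * gauss u).
have iJ : mu.-integrable `[x, +oo[ (EFin \o (fun u => (w u - w x) * gauss u)).
  apply: (@integrable_gauss _ (fun u => w u - w x) (A + A)) => //.
    exact: measurable_funB.
  by move=> u; rewrite (le_trans (ler_normB _ _))// lerD.
have iux : mu.-integrable `[x, +oo[ (EFin \o (fun u => (u - x) * gauss u)).
  have -> : (fun u => (u - x) * gauss u) = (fun u => u * gauss u - x * gauss u).
    by apply/funext => u; rewrite mulrBl.
  have ix : mu.-integrable `[x, +oo[ (EFin \o (fun u => x * gauss u)).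
    by apply: (@integrable_gauss _ (fun=> x) `|x|) => // ?.
  have := integrableB (measurable_itv `[x, +oo[ : measurable (_ :
      set (measurableTypeR R))) (integrable_id_gauss x0) ix.
  by apply: eq_integrable.
have JK : `|J| <= K * (gauss x - x * gauss_tail x).
  rewrite -Rintegral_shift_gauss// -RintegralZl//
      (le_trans (le_normr_Rintegral _ _))//.
  apply: le_Rintegral => //.
  - by have := integrable_norm iJ; apply: eq_integrable.
  - by have := integrableZl (measurable_itv `[x, +oo[ : measurable (_ :
      set (measurableTypeR R))) K iux; apply: eq_integrable.
  - move=> u /=; rewrite in_itv/= andbT => xu.
    rewrite normrM (ger0_norm (gauss_ge0 _)) mulrA ler_wpM2r ?gauss_ge0//.
    by rewrite (le_trans (lw _ _))// ger0_norm// subr_ge0.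
have JM : `|J / gauss x| <= K * (1 - x * mills x).
  rewrite normrM normfV (ger0_norm (gauss_ge0 x)) ler_pdivrMr ?gauss_gt0//.
  rewrite (le_trans JK)// /mills -mulrA ler_wpM2l//.
  by rewrite mulrBl mul1r mulrA divfK ?gauss_neq0.
have -> : x * (x * stein w x + w x) =
    w x * (x * (1 - x * mills x)) - x ^+ 2 * (J / gauss x).
  rewrite /stein (itail_split _ cw bw) -/J /mills; field; exact: gauss_neq0.
rewrite (le_trans (ler_normB _ _))// lerD//.
- rewrite normrM -[leRHS]mulr1 ler_pM ?normr_ge0//.
  rewrite ger0_norm ?mulr_ge0 ?subr_ge0//.
  by apply: le_trans sq; rewrite ler_wpM2r ?subr_ge0//; nra.
- rewrite normrM (ger0_norm (sqr_ge0 _)) (le_trans (ler_wpM2l (sqr_ge0 _) JM))//.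
  rewrite mulrCA -[leRHS]mulr1 ler_wpM2l//.
  by apply: le_trans sq; rewrite ler_wpM2r ?subr_ge0// lerDr.
Qed.

Lemma stein_bounds w A K x : bdd_by A w -> lip_by K w ->
    \int[mu]_u (w u * gauss u) = 0 ->
  [/\ `|stein w x| <= 2 * A, `|x * stein w x| <= A &
      `|x * (x * stein w x + w x)| <= A + K].
Proof.
move=> bw lw w0; have cw := lip_continuous lw.
have [x0|x0] := leP 0 x; first exact: stein_bounds_ge0.
rewrite -[x]opprK (steinN _ cw bw w0).
have [|h1 h2 h3] := @stein_bounds_ge0 (w \o -%R) A K (- x) (bdd_opp bw) (lip_opp
    lw).
  by rewrite oppr_ge0 ltW.
split.
- by rewrite normrN.
- by rewrite mulrNN.
- by rewrite mulNr normrN mulrNN.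
Qed.

(** Lipschitz continuity of f' stands in for a bound on f'', as [w] need not be differentiable. The
    product x f has derivative f + x f', at most 2A + (A + K), and [w] itself adds [K]. *)
Lemma stein_derive_lip w A K : bdd_by A w -> lip_by K w ->
    \int[mu]_u (w u * gauss u) = 0 ->
  lip_by (3 * A + 2 * K) (fun x => x * stein w x + w x).
Proof.
move=> bw lw w0 x y; have cw := lip_continuous lw.
wlog : x y / y <= x.
  move=> h; have [|/ltW] := leP y x; first exact: h.
  by move=> /h; rewrite distrC [in X in _ <= X -> _]distrC.
move=> yx; rewrite opprD addrACA (le_trans (ler_normD _ _))//.
have -> : 3 * A + 2 * K = (3 * A + K) + K by ring.
rewrite mulrDl lerD// (ger0_norm (_ : 0 <= x - y)) ?subr_ge0//.
apply: (@dist_le_is_derive _ (fun z => z * stein w z)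
  (fun z => stein w z + z * (z * stein w z + w z))) => // z _.
  have h := is_derive_stein z cw bw.
  by apply: is_derive_eq; rewrite /GRing.scale/= mulr1 addrC.
have [h1 _ h3] := stein_bounds z bw lw w0.
rewrite (le_trans (ler_normD _ _))//; lra.
Qed.

End stein_solution.

(** * Convolution powers *)

Section fubini_linear_growth.
Context {R : realType}.
Implicit Types (P Q : probability R R).

Definition fin_mean P := P.-integrable setT (EFin \o (@idfun R)).

Lemma prob_integrable_cst d (T : measurableType d) (P : probability T R) (c :
    R) : P.-integrable setT (EFin \o (fun=> c)).
Proof.
by apply: finite_measure_integrable_cst.
Qed.

Lemma dirac_Rintegral (a : R) (g : R -> R) : measurable_fun setT g ->
  \int[\d_a]_x g x = g a.
Proof.
move=> mg; rewrite /Rintegral integral_dirac//; last exact/measurable_EFinP.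
by rewrite diracT mul1e.
Qed.

Lemma dirac_fin_mean (a : R) : fin_mean (\d_a : probability R R).
Proof.
apply/integrableP; split; first by apply/measurable_EFinP; exact: measurable_id.
rewrite integral_dirac//; last first.
  apply: measurableT_comp => //.
  by apply/measurable_EFinP; exact: measurable_id.
by rewrite diracT mul1e/= ltry.
Qed.

Lemma normr_Rintegral_le d (T : measurableType d) (P : {measure set T ->
    \bar R}) (f h : T -> R) :
  P.-integrable setT (EFin \o f) -> P.-integrable setT (EFin \o h) ->
  (forall x, `|f x| <= h x) -> `|\int[P]_x f x| <= \int[P]_x h x.
Proof.
move=> itf ith fh; rewrite (le_trans (le_normr_Rintegral _ _))//.
apply: le_Rintegral => //.
by have := integrable_norm itf; apply: eq_integrable.
Qed.

Lemma prob_Rintegral_cst P (c : R) : \int[P]_x c = c.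
Proof. by rewrite Rintegral_cst// [X in fine X]probability_setT mulr1. Qed.

Lemma integrable_growth P (g : R -> R) a : fin_mean P -> measurable_fun setT g ->
  (forall x, `|g x| <= a * (1 + `|x|)) -> P.-integrable setT (EFin \o g).
Proof.
move=> fP mg ga.
apply: (@le_integrable _ _ _ P _ measurableT _ (EFin \o (fun x =>
    a * (1 + `|x|)))) => //.
- exact/measurable_EFinP.
- by move=> x _ /=; rewrite lee_fin (le_trans (ga x))// ler_norm.
- have := integrableZl measurableT a (integrableD measurableT
    (prob_integrable_cst P 1) (integrable_norm fP)).
  by apply: eq_integrable.
Qed.

Lemma integrable_bdd P (g : R -> R) A : measurable_fun setT g ->
  bdd_by A g -> P.-integrable setT (EFin \o g).
Proof.
move=> mg ga.
apply: (@le_integrable _ _ _ P _ measurableT _ (EFin \o (fun=> A))) => //.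
- exact/measurable_EFinP.
- by move=> x _ /=; rewrite lee_fin (le_trans (ga x))// ler_norm.
- exact: prob_integrable_cst.
Qed.

(** Linear growth is the class that suits integrands y g(z + y) with [g] bounded: a finite mean
    integrates it, and integrating out one variable preserves it ([inner_growth]). *)
Lemma prodprob_integrable P Q (f : R * R -> R) a : fin_mean P -> fin_mean Q ->
  measurable_fun setT f ->
  (forall x y, `|f (x, y)| <= a * (1 + `|x| + `|y|)) ->
  (P \x Q)%E.-integrable setT (EFin \o f).
Proof.
move=> fP fQ mf fa.
apply: (@le_integrable _ _ _ (P \x Q)%E _ measurableT _ (EFin \o (fun z :
    R * R => a * (1 + `|z.1| + `|z.2|)))) => //.
- exact/measurable_EFinP.
- by move=> [x y] _ /=; rewrite lee_fin (le_trans (fa x y))// ler_norm.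
have i0 : (P \x Q)%E.-integrable setT (EFin \o (fun=> 1 : R)).
  exact: (prob_integrable_cst ((P \x Q)%E : probability _ R)).
have i1 : (P \x Q)%E.-integrable setT (EFin \o (fun z : R * R => `|z.1|)).
  apply/integrable12ltyP.
    by apply/measurable_EFinP; apply: measurableT_comp.
  rewrite (eq_integral (fun x : R => `|x|%:E)); last first.
    move=> x _ /=; rewrite integral_cst// [X in (_ * X)%E]probability_setT mule1.
    by rewrite normr_id.
  by have /integrableP[] := fP.
have i2 : (P \x Q)%E.-integrable setT (EFin \o (fun z : R * R => `|z.2|)).
  apply/integrable21ltyP.
    by apply/measurable_EFinP; apply: measurableT_comp.
  rewrite (eq_integral (fun x : R => `|x|%:E)); last first.
    move=> x _ /=; rewrite integral_cst// [X in (_ * X)%E]probability_setT mule1.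
    by rewrite normr_id.
  by have /integrableP[] := fQ.
have := integrableZl measurableT a (integrableD measurableT (integrableD
    measurableT i0 i1) i2).
by apply: eq_integrable.
Qed.

Lemma section_integrable Q (f : R * R -> R) a (x : R) : fin_mean Q ->
  measurable_fun setT f ->
  (forall x y, `|f (x, y)| <= a * (1 + `|x| + `|y|)) ->
  Q.-integrable setT (EFin \o (fun y => f (x, y))).
Proof.
move=> fQ mf fa.
have a0 : 0 <= a.
  by have := le_trans (normr_ge0 _) (fa 0 0); rewrite normr0 !addr0 mulr1.
apply: (@integrable_growth _ _ (a * (1 + `|x|))) => //.
  by apply: measurableT_comp => //; exact: measurable_pair1.
move=> y; rewrite (le_trans (fa x y))// -mulrA ler_wpM2l//.
have := normr_ge0 x; have := normr_ge0 y; nra.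
Qed.

Lemma swap_growth (f : R * R -> R) a : measurable_fun setT f ->
  (forall x y, `|f (x, y)| <= a * (1 + `|x| + `|y|)) ->
  measurable_fun setT (fun z => f (z.2, z.1)) /\
  (forall x y, `|(fun z : R * R => f (z.2, z.1)) (x, y)| <= a * (1 + `|x| + `|y|)).
Proof.
move=> mf fa; split; last by move=> x y /=; rewrite addrAC.
by apply: measurableT_comp => //; exact: measurable_swap.
Qed.

Lemma prodprob_Rintegral P Q (f : R * R -> R) a : fin_mean P -> fin_mean Q ->
  measurable_fun setT f ->
  (forall x y, `|f (x, y)| <= a * (1 + `|x| + `|y|)) ->
  \int[(P \x Q)%E]_z f z = \int[P]_x \int[Q]_y f (x, y) /\
  \int[(P \x Q)%E]_z f z = \int[Q]_y \int[P]_x f (x, y).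
Proof.
move=> fP fQ mf fa; have itf := prodprob_integrable fP fQ mf fa.
have [mf' fa'] := swap_growth mf fa.
split; rewrite /Rintegral; congr fine.
- rewrite -integral12_prod_meas1//; apply: eq_integral => x _.
  by rewrite fineK//; apply: integrable_fin_num => //; exact: section_integrable fa.
- rewrite -integral21_prod_meas1//; apply: eq_integral => x _.
  by rewrite fineK//; apply: integrable_fin_num => //;
      exact: (section_integrable _ _ mf' fa').
Qed.

Lemma inner_growth Q (f : R * R -> R) a : fin_mean Q ->
  measurable_fun setT f ->
  (forall x y, `|f (x, y)| <= a * (1 + `|x| + `|y|)) ->
  measurable_fun setT (fun x => \int[Q]_y f (x, y)) /\
  (forall x, `|\int[Q]_y f (x, y)| <= (a * (1 + \int[Q]_y `|y|)) * (1 + `|x|)).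
Proof.
move=> fQ mf fa.
have a0 : 0 <= a.
  by have := le_trans (normr_ge0 _) (fa 0 0); rewrite normr0 !addr0 mulr1.
(* The Dirac mass only serves as a first factor with a mean: integrability on the product then
   yields the measurability of the inner integral. *)
have fP : fin_mean (\d_(0 : R) : probability R R).
  exact: dirac_fin_mean.
have itf := prodprob_integrable fP fQ mf fa.
split.
  apply: (@measurableT_comp _ _ _ _ _ _ (@fine R)) => //.
  exact: (measurable_fubini_F itf).
move=> x; have ix := section_integrable x fQ mf fa.
rewrite (le_trans (le_normr_Rintegral _ _))//.
have iy : Q.-integrable setT (EFin \o (fun y : R => `|y|)).
  by have := integrable_norm fQ; apply: eq_integrable.
have -> : a * (1 + \int[Q]_y `|y|) * (1 + `|x|) =
    a * (1 + `|x|) + a * (1 + `|x|) * \int[Q]_y `|y| by ring.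
rewrite -RintegralZl// -[X in X + _](prob_Rintegral_cst Q) -RintegralD//.
- apply: le_Rintegral => //.
  + by have := integrable_norm ix; apply: eq_integrable.
  + apply: (@integrable_growth _ _ (a * (1 + `|x|))) => //.
      by apply: measurable_funD => //; apply: measurable_funM => //;
          exact: measurableT_comp.
    move=> y; rewrite ger0_norm; first by rewrite [leRHS]mulrDr mulr1.
    by rewrite addr_ge0 ?mulr_ge0// addr_ge0.
  + move=> y _; rewrite (le_trans (fa x y))//
      -{1}[a * (1 + `|x|)]mulr1 -mulrDr -mulrA ler_wpM2l//.
    have := normr_ge0 x; have := normr_ge0 y; nra.
- exact: prob_integrable_cst.
- by have := integrableZl measurableT (a * (1 + `|x|)) iy; apply: eq_integrable.
Qed.

End fubini_linear_growth.

(** * The law of a sum of independent variables *)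

Section law_of_sum.
Context {R : realType}.
Variable F : probability R R.

Definition add_pair (yz : R * R) : R := yz.2 + yz.1.

Lemma measurable_add_pair : measurable_fun setT add_pair.
Proof. exact: measurable_funD. Qed.

HB.instance Definition _ := @isMeasurableFun.Build _ _ _ _ add_pair
    measurable_add_pair.

(** The set function [lawS] rebuilt as a genuine probability measure, so that one can integrate
    against it. [add_pair] adds in the order [z + y] to match the recursion of [lawS]. *)
Fixpoint law (n : nat) : probability R R :=
  match n with
  | 0 => \d_(0 : R)
  | m.+1 => distribution (F \x law m)%E add_pair
  end.

Lemma lawSE n A : measurable A -> lawS F n A = law n A.
Proof.
elim: n A => [//|n IH] A mA /=.
rewrite /distribution /pushforward /= /product_measure1.
apply: eq_integral => y _ /=; rewrite IH.
  by congr (law n _); apply/seteqP; split => z; rewrite /xsection/= inE.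
rewrite -[X in measurable X]setTI.
have h : measurable_fun setT (fun z : R => z + y) by exact: measurable_funD.
exact: (h measurableT A mA).
Qed.

Hypothesis Fm : fin_mean F.

Lemma law_fin_mean n : fin_mean (law n).
Proof.
elim: n => [|n IH]; first exact: dirac_fin_mean.
have h : (F \x law n)%E.-integrable setT (EFin \o add_pair).
  apply: (@prodprob_integrable _ _ _ _ 1) => //.
  by move=> x y; rewrite mul1r /add_pair/= (le_trans (ler_normD _ _))//
      addrC lerD// lerDr.
apply/integrableP; split; first by apply/measurable_EFinP; exact: measurable_id.
rewrite ge0_integral_distribution//=; last by do 2 apply: measurableT_comp => //.
by have /integrableP[] := h.
Qed.

Lemma law_Rintegral n (g : R -> R) a : measurable_fun setT g ->
  (forall x, `|g x| <= a * (1 + `|x|)) ->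
  \int[law n.+1]_x g x = \int[law n]_z \int[F]_y g (z + y).
Proof.
move=> mg ga.
have a0 : 0 <= a.
  by have := le_trans (normr_ge0 _) (ga 0); rewrite normr0 !addr0 mulr1.
have mg2 : measurable_fun setT (fun z : R * R => g (add_pair z)).
  exact: measurableT_comp.
have ga2 x y : `|g (add_pair (x, y))| <= a * (1 + `|x| + `|y|).
  rewrite (le_trans (ga _))// ler_wpM2l// -addrA lerD2l /add_pair/= addrC.
  exact: ler_normD.
have [_ <-] := prodprob_Rintegral Fm (law_fin_mean n) mg2 ga2.
rewrite /Rintegral; congr fine; rewrite integral_distribution//.
- exact/measurable_EFinP.
- exact: (prodprob_integrable Fm (law_fin_mean n) mg2 ga2).
Qed.

Lemma shift_growth (g : R -> R) A : measurable_fun setT g -> bdd_by A g ->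
  [/\ measurable_fun setT (fun z : R * R => g (z.1 + z.2)),
      (forall x y, `|g (x + y)| <= A * (1 + `|x| + `|y|)),
      measurable_fun setT (fun z : R * R => z.2 * g (z.1 + z.2)) &
      (forall x y, `|y * g (x + y)| <= A * (1 + `|x| + `|y|))].
Proof.
move=> mg bg; have A0 := bdd_ge0 bg.
have m1 : measurable_fun setT (fun z : R * R => g (z.1 + z.2)).
  by apply: measurableT_comp => //; exact: measurable_funD.
split => //.
- move=> x y; rewrite (le_trans (bg _))// ler_peMr// -addrA lerDl addr_ge0//.
- exact: measurable_funM.
- by move=> x y; rewrite normrM mulrC ler_pM// lerDr addr_ge0.
Qed.

Lemma shift_Rintegral (g : R -> R) A : measurable_fun setT g -> bdd_by A g ->
  measurable_fun setT (fun z : R => \int[F]_y g (z + y)) /\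
  bdd_by A (fun z : R => \int[F]_y g (z + y)).
Proof.
move=> mg bg; have [m1 g1 m2 g2] := shift_growth mg bg.
split; first by case: (inner_growth Fm m1 g1).
move=> z; rewrite -[leRHS](prob_Rintegral_cst F); apply: normr_Rintegral_le => //.
- exact: (section_integrable _ Fm m1 g1).
- exact: prob_integrable_cst.
Qed.

(* Exchangeability: all the summands contribute equally to [E S g(S)]. *)
Lemma law_swap n (g : R -> R) A : measurable_fun setT g -> bdd_by A g ->
  \int[law n.+1]_x (x * g x) = n.+1%:R * \int[law n]_z \int[F]_y (y * g (z + y)).
Proof.
elim: n g A => [|n IH] g A mg bg; have A0 := bdd_ge0 bg.
all: have gr (x : R) : `|x * g x| <= A * (1 + `|x|)
    by rewrite normrM mulrC ler_pM// lerDr.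
all: have mxg : measurable_fun setT (fun x : R => x * g x)
    by apply: measurable_funM.
all: have [m1 g1 m2 g2] := shift_growth mg bg.
  rewrite (law_Rintegral _ mxg gr) mul1r !dirac_Rintegral.
  - by under eq_Rintegral do rewrite add0r;
      under [RHS]eq_Rintegral do rewrite add0r.
  - by have [] := inner_growth Fm m2 g2.
  - apply: (@inner_growth _ F (fun z => (z.1 + z.2) * g (z.1 + z.2)) A Fm _ _).1.
      by apply: measurable_funM => //; exact: measurable_funD.
    move=> x y; rewrite (le_trans (gr _))// ler_wpM2l// -addrA lerD2l.
    exact: ler_normD.
have [mT bT] := shift_Rintegral mg bg.
have [mphi gphi] := inner_growth Fm m2 g2.
rewrite (law_Rintegral _ mxg gr).
have -> : \int[law n.+1]_z \int[F]_y ((z + y) * g (z + y)) =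
    \int[law n.+1]_z (z * \int[F]_y g (z + y)) + \int[law n.+1]_z \int[F]_y (y *
        g (z + y)).
  rewrite -RintegralD//; last 2 first.
  - apply: (@integrable_growth _ _ _ A (law_fin_mean _)).
      exact: measurable_funM.
    by move=> x; rewrite normrM mulrC ler_pM// lerDr.
  - exact: (integrable_growth (law_fin_mean _) mphi gphi).
  apply: eq_Rintegral => z _; rewrite -RintegralZl//; last first.
    exact: (section_integrable _ Fm m1 g1).
  rewrite -RintegralD//; last 2 first.
  - have := integrableZl measurableT z (section_integrable z Fm m1 g1).
    by apply: eq_integrable.
  - exact: (section_integrable _ Fm m2 g2).
  by apply: eq_Rintegral => y _; rewrite mulrDl.
rewrite (IH _ A)// [in RHS](law_Rintegral _ mphi gphi).
rewrite [X in _ + X](law_Rintegral _ mphi gphi).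
rewrite -[n.+2]addn1 natrD mulrDl mul1r; congr (_ * _ + _).
apply: eq_Rintegral => z _.
(* Two independent summands next to [z]: exchanging them by Fubini gives the terms of the induction
   hypothesis the form of the new one. *)
pose f (w : R * R) := w.1 * g (z + w.1 + w.2).
have mf : measurable_fun setT f.
  apply: measurable_funM => //; apply: measurableT_comp => //.
  by apply: measurable_funD => //; exact: measurable_funD.
have gf x y : `|f (x, y)| <= A * (1 + `|x| + `|y|).
  by rewrite /f normrM mulrC ler_pM// addrAC lerDr addr_ge0.
have [h1 h2] := prodprob_Rintegral Fm Fm mf gf.
transitivity (\int[F]_x \int[F]_y f (x, y)).
  apply: eq_Rintegral => y _; rewrite -RintegralZl//.
  have := section_integrable (z + y) Fm m1 g1.
  by apply: eq_integrable.
rewrite -h1 h2; apply: eq_Rintegral => y _; apply: eq_Rintegral => x _.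
by rewrite /f/= addrAC.
Qed.

End law_of_sum.
Arguments law {R} F n : simpl never.

(** * The central limit theorem *)

Section clt.
Context {R : realType}.

(** The increment of [f1] is bounded both by its Lipschitz constant and by twice its supremum.
    Keeping the minimum makes the remainder, once multiplied by a further v, integrable under a
    second moment only. *)
Lemma taylor1_le (f f1 : R -> R) (C u v : R) :
  (forall x : R, is_derive x 1 f (f1 x)) -> bdd_by C f1 -> lip_by C f1 ->
  `|f (u + v) - f u - v * f1 u| <= 2 * C * `|v| * Num.min `|v| 1.
Proof.
move=> fd bf lf; have C0 := bdd_ge0 bf.
pose p t := f t - t * f1 u.
have pd (t : R) : is_derive t 1 p (f1 t - f1 u).
  have h := fd t; apply: is_derive_eq; rewrite /GRing.scale/=; ring.
have key t : `|t - u| <= `|v| -> `|f1 t - f1 u| <= 2 * C * Num.min `|v| 1.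
  move=> tu; rewrite minr_pMr ?mulr_ge0// le_min; apply/andP; split.
    by rewrite (le_trans (lf _ _))// ler_pM//; lra.
  by rewrite mulr1 (le_trans (ler_normB _ _))//; have := bf t; have := bf u; lra.
have -> : f (u + v) - f u - v * f1 u = p (u + v) - p u by rewrite /p; ring.
rewrite -[leRHS]mulrA [`|v| * _]mulrC mulrA.
have [v0|/ltW v0] := leP 0 v.
  rewrite {3}(_ : v = u + v - u); last by rewrite addrAC subrr add0r.
  rewrite [X in _ * X]ger0_norm; last by rewrite addrAC subrr add0r.
  apply: (@dist_le_is_derive _ p (fun t => f1 t - f1 u)) => //;
      first by rewrite lerDl.
  move=> z /andP[uz zv]; apply: key; rewrite !ger0_norm ?subr_ge0//; lra.
rewrite distrC {3}(_ : v = - (u - (u + v))); last by ring.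
rewrite normrN [X in _ * X]ger0_norm; last by lra.
apply: (@dist_le_is_derive _ p (fun t => f1 t - f1 u)) => //; first by lra.
move=> z /andP[uz zv]; apply: key.
rewrite [leRHS]ler0_norm// ler0_norm; lra.
Qed.

Variable F : probability R R.
Hypothesis hF : calF F.

Lemma integrable_sqr : F.-integrable setT (EFin \o (fun x : R => x ^+ 2)).
Proof.
have [h [_ _]] := hF; apply/integrableP; split.
  by apply/measurable_EFinP; exact: (measurable_funX 2 (@measurable_id _ _ setT)).
rewrite (eq_integral (fun x : R => (x ^+ 2)%:E))// => x _ /=.
by rewrite ger0_norm ?sqr_ge0.
Qed.

Lemma calF_fin_mean : fin_mean F.
Proof.
have i2 := integrableD measurableT (prob_integrable_cst F 1) integrable_sqr.
apply: (le_integrable measurableT _ _ i2).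
  by apply/measurable_EFinP; exact: measurable_id.
move=> x _ /=; rewrite lee_fin [leRHS]ger0_norm ?addr_ge0 ?sqr_ge0//.
by rewrite ler_norml; apply/andP; split; nra.
Qed.

Lemma calF_mean0 : \int[F]_y y = 0.
Proof. by have [_ [h _]] := hF; rewrite /Rintegral h. Qed.

Lemma sigma1sq_gt0 : 0 < sigma1sq F.
Proof.
have s0 : 0 <= sigma1sq F by apply: Rintegral_ge0 => x _; exact: sqr_ge0.
rewrite lt_neqAle s0 andbT eq_sym; apply/eqP => s2.
have [_ [_ ndeg]] := hF; apply: ndeg; exists 0.
have e0 : (\int[F]_x `|(EFin \o (fun x : R => (x ^+ 2)%R)) x| = 0)%E.
  rewrite (eq_integral (fun x : R => (x ^+ 2)%:E)); last first.
    by move=> x _ /=; rewrite ger0_norm ?sqr_ge0.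
  rewrite -[LHS]fineK; first by congr EFin.
  exact: (integrable_fin_num measurableT integrable_sqr).
have m2 := measurable_int _ integrable_sqr.
have /(ae_eq_integral_abs _ measurableT m2).1 [N [mN N0 sN]] := e0.
have : F (~` [set 0]) = 0%E.
  apply: (subset_measure0 _ mN _ N0) => //; first exact: measurableC.
  move=> x /= x0; apply: sN => /= /(_ I) [] /eqP.
  by rewrite sqrf_eq0 => /eqP.
rewrite probability_setC// => /eqP; by rewrite sube_eq// ?add0e => /eqP <-.
Qed.

Lemma Bn_ge0 n : 0 <= Bn F n. Proof. exact: sqrtr_ge0. Qed.

Lemma sqr_Bn n : Bn F n ^+ 2 = n%:R * sigma1sq F.
Proof. by rewrite sqr_sqrtr// mulr_ge0// ltW// sigma1sq_gt0. Qed.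

Lemma Bn_gt0 n : 0 < Bn F n.+1.
Proof. by rewrite sqrtr_gt0 mulr_gt0// sigma1sq_gt0. Qed.

(* The first term vanishes as [B] grows by dominated convergence, which is why
   a second moment is enough. *)
Definition stein_rate (B : R) : R :=
  (\int[F]_y (y ^+ 2 * Num.min (`|y| / B) 1)) / sigma1sq F + (\int[F]_y `|y|) / B.

Lemma integrable_trunc (B : R) : 0 < B ->
  F.-integrable setT (EFin \o (fun y : R => y ^+ 2 * Num.min (`|y| / B) 1)).
Proof.
move=> B0; apply: (le_integrable measurableT _ _ integrable_sqr).
  apply/measurable_EFinP; apply: measurable_funM => //.
  by apply: measurable_minr => //; apply: measurable_funM => //;
      exact: measurableT_comp.
move=> x _ /=; rewrite lee_fin normrM ler_piMr//.
by rewrite ger0_norm ?ge_min ?lexx ?orbT// le_min ler01 divr_ge0// ltW.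
Qed.

Lemma integrable_abs : F.-integrable setT (EFin \o (fun y : R => `|y|)).
Proof. by have := integrable_norm calF_fin_mean; apply: eq_integrable. Qed.

(** By exchangeability the mean of (S/B) f(S/B) is [n.+1] times that of y f((z + y)/B)/B for one
    summand y independent of the others, of sum z. Expanding at z/B, the order zero term vanishes
    because y is centred, and the next one is exactly f1(z/B) because [n.+1] times the variance is
    B^2. The two parts of [stein_rate] pay for the Taylor remainder and for replacing f1((z + y)/B)
    by f1(z/B). *)
Lemma stein_error n (f f1 : R -> R) (C D : R) (B := Bn F n.+1) :
  (forall x : R, is_derive x 1 f (f1 x)) -> bdd_by C f1 -> lip_by C f1 ->
      bdd_by D f ->
  `| \int[law F n.+1]_x (f1 (x / B) - x / B * f (x / B)) | <= 2 * C * stein_rate B.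
Proof.
move=> fd b1 l1 bf.
have C0 := bdd_ge0 b1; have D0 := bdd_ge0 bf.
have B0 : 0 < B := Bn_gt0 n; have Bn0 : B != 0 by rewrite gt_eqF.
have B2 : B ^+ 2 = n.+1%:R * sigma1sq F := sqr_Bn n.+1.
have s0 := sigma1sq_gt0.
have Fm := calF_fin_mean.
have cf : continuous f by move=> x; exact: is_derive_continuous (fd x).
have cf1 := lip_continuous l1.
have mf := continuous_measurable_fun cf; have mf1 := continuous_measurable_fun cf1.
have mdiv : measurable_fun setT (fun x : R => x / B) by exact: measurable_funM.
have mfB : measurable_fun setT (fun x : R => B^-1 * f (x / B)).
  by apply: measurable_funM => //; exact: measurableT_comp.
have mf1B : measurable_fun setT (fun x : R => f1 (x / B))
    by exact: measurableT_comp.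
have bfB : bdd_by (B^-1 * D) (fun x : R => B^-1 * f (x / B)).
  by move=> x; rewrite normrM ger0_norm ?invr_ge0 ?(ltW B0)// ler_wpM2l//
      invr_ge0 ltW.
have bf1B : bdd_by C (fun x : R => f1 (x / B)) by move=> x; exact: b1.
have i1 := integrable_bdd (law F n.+1) mf1B bf1B.
have i2 : (law F n.+1).-integrable setT (EFin \o (fun x : R =>
    x * (B^-1 * f (x / B)))).
  apply: (@integrable_growth _ _ _ (B^-1 * D) (law_fin_mean Fm _));
      first exact: measurable_funM.
  by move=> x; rewrite normrM mulrC ler_pM// lerDr.
have -> : \int[law F n.+1]_x (f1 (x / B) - x / B * f (x / B)) =
   \int[law F n.+1]_x f1 (x / B) - \int[law F n.+1]_x (x * (B^-1 * f (x / B))).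
  by rewrite -RintegralB//; apply: eq_Rintegral => x _; rewrite mulrA.
have g1 x : `|f1 (x / B)| <= C * (1 + `|x|).
  by rewrite (le_trans (b1 _))// ler_peMr// lerDl.
rewrite (law_swap Fm n mfB bfB) (law_Rintegral Fm n mf1B g1).
set m := \int[F]_y (y ^+ 2 * Num.min (`|y| / B) 1).
have [sm1 sg1 _ _] := shift_growth mf1B bf1B.
have [_ _ sm2 sg2] := shift_growth mfB bfB.
have in1 z : `|\int[F]_y f1 ((z + y) / B) - f1 (z / B)| <= C / B * \int[F]_y `|y|.
  rewrite -[X in _ - X](prob_Rintegral_cst F) -RintegralB//; last 2 first.
  - exact: (section_integrable z Fm sm1 sg1).
  - exact: prob_integrable_cst.
  rewrite -RintegralZl//; last exact: integrable_abs.
  apply: normr_Rintegral_le.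
  - by have := integrableB measurableT (section_integrable z Fm sm1 sg1)
      (prob_integrable_cst F (f1 (z / B))); apply: eq_integrable.
  - by have := integrableZl measurableT (C / B) integrable_abs;
      apply: eq_integrable.
  - move=> y; rewrite (le_trans (l1 _ _))// -mulrBl addrAC subrr add0r normrM.
    by rewrite (ger0_norm (ltW (_ : 0 < B^-1))) ?invr_gt0// mulrA mulrAC.
have in2 z : `|\int[F]_y (y * (B^-1 * f ((z + y) / B))) - sigma1sq F / B ^+ 2 *
    f1 (z / B)|
    <= 2 * C / B ^+ 2 * m.
  have iy : F.-integrable setT (EFin \o (fun y : R => y * (B^-1 * f (z / B)))).
    by have := integrableZl measurableT (B^-1 * f (z / B)) Fm;
        apply: eq_integrable => // y _ /=; rewrite -EFinM mulrC.
  have iq : F.-integrable setT (EFin \o (fun y : R =>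
      y ^+ 2 * (f1 (z / B) / B ^+ 2))).
    by have := integrableZl measurableT (f1 (z / B) / B ^+ 2) integrable_sqr;
        apply: eq_integrable => // y _ /=; rewrite -EFinM mulrC.
  have is_ := section_integrable z Fm sm2 sg2.
  have -> : sigma1sq F / B ^+ 2 * f1 (z / B) =
      \int[F]_y (y ^+ 2 * (f1 (z / B) / B ^+ 2)).
    by rewrite RintegralZr//; [rewrite mulrAC mulrA|exact: integrable_sqr].
  (* The subtracted term has integral 0, the law being centred. *)
  have -> : \int[F]_y (y * (B^-1 * f ((z + y) / B))) =
     \int[F]_y (y * (B^-1 * f ((z + y) / B)) - y * (B^-1 * f (z / B))).
    rewrite RintegralB// [X in _ - X]RintegralZr//.
    by rewrite calF_mean0 mul0r subr0.
  have ib : F.-integrable setT (EFin \o (fun y : R =>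
      y * (B^-1 * f ((z + y) / B)) - y * (B^-1 * f (z / B)))).
    by have := integrableB measurableT is_ iy; apply: eq_integrable.
  rewrite -RintegralB// -RintegralZl//; last exact: integrable_trunc.
  apply: normr_Rintegral_le.
  - by have := integrableB measurableT ib iq; apply: eq_integrable.
  - by have := integrableZl measurableT (2 * C / B ^+ 2) (integrable_trunc B0);
      apply: eq_integrable.
  - move=> y; have T := taylor1_le (z / B) (y / B) fd b1 l1.
    have -> : y * (B^-1 * f ((z + y) / B)) - y * (B^-1 * f (z / B)) - y ^+ 2 *
        (f1 (z / B) / B ^+ 2) =
      (y / B) * (f (z / B + y / B) - f (z / B) - y / B * f1 (z / B)).
      by rewrite -mulrDl; field.
    rewrite normrM; apply: (le_trans (ler_wpM2l (normr_ge0 (y / B)) T)).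
    have -> : `|y / B| = `|y| / B by rewrite normrM normfV (ger0_norm (ltW B0)).
    rewrite -(real_normK (num_real y)).
    by rewrite le_eqVlt; apply/orP; left; apply/eqP; field.
have mi2 := (inner_growth Fm sm2 sg2).
have mi1 := (inner_growth Fm sm1 sg1).
have Lm := law_fin_mean Fm n.
have ii1 := integrable_growth Lm mi1.1 mi1.2.
have ii2 := integrable_growth Lm mi2.1 mi2.2.
rewrite -RintegralZl// -RintegralB//; last first.
  by have := integrableZl measurableT n.+1%:R ii2; apply: eq_integrable.
rewrite -[leRHS](prob_Rintegral_cst (law F n)).
apply: normr_Rintegral_le.
- have ii3 := integrableZl measurableT n.+1%:R ii2.
  by have := integrableB measurableT ii1 ii3; apply: eq_integrable.
- exact: prob_integrable_cst.
move=> z; have /ler_normlP[a1 a2] := in1 z;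
    have /(ler_wpM2l (ler0n R n.+1)) := in2 z.
rewrite -{1}(ger0_norm (ler0n R n.+1)) -normrM mulrBr.
have -> : n.+1%:R * (sigma1sq F / B ^+ 2 * f1 (z / B)) = f1 (z / B).
  by rewrite mulrA mulrA -B2 divff ?mul1r// expf_neq0.
have -> : n.+1%:R * (2 * C / B ^+ 2 * m) = 2 * C * (m / sigma1sq F).
  have fld (N s c k : R) : N != 0 -> s != 0 ->
      N * (2 * c / (N * s) * k) = 2 * c * (k / s).
    by move=> N0 s1; field; rewrite N0 s1.
  by rewrite B2 fld// ?pnatr_eq0// gt_eqF.
move=> /ler_normlP[b1' b2'].
rewrite /stein_rate -/m mulrDr.
have h0 : 0 <= C * (\int[F]_y `|y| / B).
  by rewrite mulr_ge0// divr_ge0 ?(ltW B0)//; apply: Rintegral_ge0.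
rewrite ler_norml; apply/andP; split; lra.
Qed.

End clt.

(** * From Lipschitz test functions to distribution functions *)

Section clt_uniform.
Context {R : realType}.
Notation mu := (@lebesgue_measure R).

Lemma Rintegral_gauss : \int[mu]_x (1 * gauss x) = Num.sqrt (2 * pi) :> R.
Proof.
have h := @integral_normal_pdf R 0 1.
have : \int[mu]_x (normal_pdf 0 1 x) = 1 by rewrite /Rintegral h.
under eq_Rintegral do rewrite normal_pdf01 -[gauss _]mul1r.
rewrite (@RintegralZl _ _ _ mu setT (fun x =>
    1 * gauss x) _ measurableT (integrable_gauss1 measurableT)).
move=> /(congr1 (fun z => Num.sqrt (2 * pi) * z)); rewrite mulr1 mulVKf//.
by rewrite gt_eqF// sqrt2pi_gt0.
Qed.

Definition gauss_mean (h : R -> R) : R :=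
  (Num.sqrt (2 * pi))^-1 * \int[mu]_x (h x * gauss x).

Lemma gauss_mean_bdd h A : measurable_fun setT h -> bdd_by A h ->
    `|gauss_mean h| <= A.
Proof.
move=> mh bh; rewrite /gauss_mean normrM ger0_norm ?invr_ge0 ?sqrtr_ge0//.
rewrite mulrC ler_pdivrMr ?sqrt2pi_gt0// -Rintegral_gauss -Rintegral_cstM_gauss//.
apply: normr_Rintegral_le.
- exact: (integrable_gauss measurableT mh bh).
- by apply: (@integrable_gauss _ (fun=> A) `|A|) => // ?.
- by move=> x; rewrite normrM (ger0_norm (gauss_ge0 _)) ler_wpM2r ?gauss_ge0.
Qed.

Lemma gauss_mean_le g h A B : measurable_fun setT g -> bdd_by A g ->
  measurable_fun setT h -> bdd_by B h -> (forall x, g x <= h x) ->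
  gauss_mean g <= gauss_mean h.
Proof.
move=> mg bg mh bh gh; rewrite /gauss_mean ler_wpM2l ?invr_ge0 ?sqrtr_ge0//.
apply: le_Rintegral => //.
- exact: (integrable_gauss measurableT mg bg).
- exact: (integrable_gauss measurableT mh bh).
- by move=> x _; rewrite ler_wpM2r ?gauss_ge0.
Qed.

Lemma Phi_indic (x : R) : Phi x = gauss_mean \1_(`]-oo, x[).
Proof.
rewrite /Phi /normal_prob /gauss_mean.
rewrite [LHS](_ : _ = \int[mu]_(u in `]-oo, x[) ((Num.sqrt (2 * pi))^-1 * (1 *
    gauss u))).
  rewrite RintegralZl//; last exact: integrable_gauss1.
  congr (_ * _); rewrite Rintegral_mkcond; apply: eq_Rintegral => u _.
  by rewrite patchE indicE; case: ifP => _; rewrite ?mul1r ?mul0r.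
rewrite /Rintegral; congr fine; apply: eq_integral => u _.
by rewrite normal_pdf01 mul1r.
Qed.

Lemma bdd_indic (A : set R) : bdd_by 1 (\1_A : R -> R).
Proof. by move=> x; rewrite indicE; case: (_ \in _); rewrite ?normr1 ?normr0. Qed.

(** The normal density is at most 1, which is precise enough here. *)
Lemma Phi_lip (x d : R) : 0 <= d -> Phi (x + d) <= Phi x + d.
Proof.
move=> d0; rewrite !Phi_indic /gauss_mean.
have s1 : (Num.sqrt (2 * pi))^-1 <= 1 :> R.
  rewrite invf_le1 ?sqrt2pi_gt0// -[leLHS]sqrtr1 ler_sqrt ?mulr_ge0 ?pi_ge0//.
  have := @pi_ge2 R; lra.
have i1 (a b : itv_bound R) : mu.-integrable setT (EFin \o (fun u =>
    \1_([set` Interval a b]) u * gauss u)).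
  by apply: (integrable_gauss measurableT _ (@bdd_indic _)).
have -> : \int[mu]_u (\1_(`]-oo, (x + d)[) u * gauss u) =
  \int[mu]_u (\1_(`]-oo, x[) u * gauss u) + \int[mu]_u (\1_(`[x, (x + d)[) u *
      gauss u).
  rewrite -RintegralD//; apply: eq_Rintegral => u _; rewrite -mulrDl; congr (_ * _).
  rewrite !indicE !mem_setE !in_itv/=.
  have [ux|xu] := ltP u x.
    by rewrite (lt_le_trans ux) ?lerDl// addr0.
  by rewrite add0r.
rewrite mulrDr lerD2l.
have muE : mu `[x, (x + d)[ = d%:E.
  have := @lebesgue_measure_itv R `[x, (x + d)[ => /= ->.
  have [d1|d1] := ltP x (x + d).
    by rewrite lte_fin d1 -EFinB addrAC subrr add0r.
  by rewrite lte_fin ltNge d1/=; congr EFin; apply/eqP; rewrite eq_le d0/=;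
      move: d1; rewrite gerDl.
have : \int[mu]_u (\1_(`[x, (x + d)[) u * gauss u) <= d.
  have dE : \int[mu]_u (\1_(`[x, (x + d)[) u) = d.
    rewrite /Rintegral integral_indic//.
    by rewrite setIT; move: muE => /= ->.
  rewrite -[leRHS]dE; apply: le_Rintegral => //.
  - apply/integrableP; split; first by apply/measurable_EFinP;
      exact: measurable_indic.
    rewrite [ltLHS](_ : _ = d%:E) ?ltry// -muE.
    transitivity (\int[mu]_u (\1_(`[x, (x + d)[) u)%:E)%E.
      by apply: eq_integral => u _ /=; rewrite ger0_norm.
    by rewrite integral_indic// setIT.
  - move=> u _; rewrite indicE; case: (_ \in _); rewrite ?mul1r ?mul0r//.
    exact: gauss_le1.
move=> h; apply: le_trans h.
rewrite -[leRHS]mul1r ler_wpM2r//; apply: Rintegral_ge0 => u _.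
by rewrite mulr_ge0// gauss_ge0.
Qed.

(** A piecewise linear cutoff falling from 1 at [x] to 0 at [x + d]; it lies between the indicators
    of the half-lines ending at these two points. *)
Definition ramp (x d u : R) : R := Num.max 0 (Num.min 1 ((x + d - u) / d)).

Lemma ramp_ge0 x d u : 0 <= ramp x d u.
Proof. by rewrite le_max lexx. Qed.

Lemma ramp_le1 x d u : ramp x d u <= 1.
Proof. by rewrite ge_max ler01 ge_min lexx. Qed.

Lemma ramp_bdd x d : bdd_by 1 (ramp x d).
Proof. by move=> u; rewrite ger0_norm ?ramp_ge0// ramp_le1. Qed.

Lemma ramp_lip x d : 0 < d -> lip_by d^-1 (ramp x d).
Proof.
move=> d0 u v.
wlog uv : u v / u <= v.
  move=> h; have [|/ltW] := leP u v; first exact: h.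
  by move=> /h; rewrite distrC [in X in _ <= X -> _]distrC.
rewrite [X in _ <= _ * X]ler0_norm ?subr_le0// opprB.
have : (x + d - v) / d = (x + d - u) / d - d^-1 * (v - u) by field; rewrite gt_eqF.
have : 0 <= d^-1 * (v - u) by rewrite mulr_ge0 ?invr_ge0 ?subr_ge0// ltW.
(* The two affine arguments differ exactly by [c]; every combination of the clippings is then linear
   arithmetic. *)
rewrite /ramp; move: (d^-1 * (v - u)) ((x + d - v) / d) ((x + d - u) / d) =>
    c p q c0 pq.
have mn (t : R) : (1 <= t /\ Num.min 1 t = 1) \/ (t <= 1 /\ Num.min 1 t = t).
  by case: (leP 1 t) => ?; [left|right]; split => //; exact: ltW.
have mx (t : R) : (0 <= t /\ Num.max 0 t = t) \/ (t <= 0 /\ Num.max 0 t = 0).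
  by case: (leP 0 t) => ?; [left|right]; split => //; exact: ltW.
case: (mn q) => -[? ->]; case: (mn p) => -[? ->].
all: case: (mx 1) => -[? e1]; case: (mx q) => -[? e2]; case: (mx p) => -[? e3].
all: rewrite ?e1 ?e2 ?e3 ler_norml; apply/andP; split; lra.
Qed.

Lemma ramp_indic_ge x d u : 0 < d -> \1_(`]-oo, x[) u <= ramp x d u.
Proof.
move=> d0; rewrite indicE mem_setE in_itv/=; have [ux|_] := ltP u x;
    last exact: ramp_ge0.
by rewrite le_max le_min lexx ler_pdivlMr//
    mul1r lerBrDr addrC lerD2r (ltW ux) orbT.
Qed.

Lemma ramp_indic_le x d u : 0 < d -> ramp x d u <= \1_(`]-oo, (x + d)[) u.
Proof.
move=> d0; rewrite indicE mem_setE in_itv/=; have [ux|ux] := ltP u (x + d);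
    first exact: ramp_le1.
by rewrite ge_max lexx/= ge_min ler_pdivrMr// mul0r subr_le0 ux orbT.
Qed.

Variable F : probability R R.
Hypothesis hF : calF F.

(** Centring [h] doubles its bound to 2A. The derivative of the Stein solution is then bounded by 4A
    and has Lipschitz constant 6A + 2K; 12A + 2K covers both. *)
Lemma clt_lip n (h : R -> R) A K (B := Bn F n.+1) : bdd_by A h -> lip_by K h ->
  `|\int[law F n.+1]_x h (x / B) - gauss_mean h| <=
      2 * (12 * A + 2 * K) * stein_rate F B.
Proof.
move=> bh lh; have ch := lip_continuous lh; have mh := continuous_measurable_fun ch.
have A0 := bdd_ge0 bh.
have K0 : 0 <= K by have := le_trans (normr_ge0 _) (lh 1 0);
    rewrite subr0 normr1 mulr1.
pose w u := h u - gauss_mean h.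
have bw : bdd_by (2 * A) w.
  move=> u; rewrite (le_trans (ler_normB _ _))// mulrDl mul1r lerD//.
  exact: gauss_mean_bdd.
have lw : lip_by K w by move=> u v; rewrite /w opprD addrACA subrr addr0.
have cw := lip_continuous lw.
have w0 : \int[mu]_u (w u * gauss u) = 0.
  rewrite /w; under eq_Rintegral do rewrite mulrBl.
  rewrite RintegralB//; last 2 first.
  - exact: (integrable_gauss measurableT mh bh).
  - by apply: (@integrable_gauss _ (fun=> gauss_mean h) `|gauss_mean h|) => // ?.
  rewrite Rintegral_cstM_gauss// Rintegral_gauss /gauss_mean mulrAC mulVf ?mul1r
      ?subrr//.
  by rewrite gt_eqF// sqrt2pi_gt0.
have f1E u : u * stein w u + w u - u * stein w u = w u
    by rewrite addrAC subrr add0r.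
have C1 : bdd_by (12 * A + 2 * K) (fun u => u * stein w u + w u).
  move=> u; have [_ h1 _] := stein_bounds u bw lw w0.
  rewrite (le_trans (ler_normD _ _))//; have := bw u; lra.
have C2 : lip_by (12 * A + 2 * K) (fun u => u * stein w u + w u).
  move=> u v; rewrite (le_trans (stein_derive_lip bw lw w0 u v))// ler_wpM2r//; lra.
have C3 : bdd_by (2 * (2 * A)) (stein w) by move=> u;
    have [] := stein_bounds u bw lw w0.
have := @stein_error _ _ hF n _ _ _ _ (fun x => is_derive_stein x cw bw) C1 C2 C3.
rewrite -/B; under eq_Rintegral do rewrite f1E.
rewrite /w RintegralB//.
- by rewrite prob_Rintegral_cst.
- apply: (@integrable_bdd _ _ _ A); last by move=> u; exact: bh.
  by apply: measurableT_comp => //; exact: measurable_funM.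
- exact: prob_integrable_cst.
Qed.

Lemma prob_le_Rintegral (P : probability R R) (A : set R) (g : R -> R) C :
  measurable A -> measurable_fun setT g -> bdd_by C g ->
  (forall x, \1_A x <= g x) -> fine (P A) <= \int[P]_x g x.
Proof.
move=> mA mg bg Ag.
have -> : fine (P A) = \int[P]_x (\1_A x)
    by rewrite /Rintegral integral_indic// setIT.
apply: le_Rintegral => //; last exact: integrable_bdd bg.
exact: (integrable_bdd _ _ (@bdd_indic A)).
Qed.

Lemma prob_ge_Rintegral (P : probability R R) (A : set R) (g : R -> R) C :
  measurable A -> measurable_fun setT g -> bdd_by C g ->
  (forall x, g x <= \1_A x) -> \int[P]_x g x <= fine (P A).
Proof.
move=> mA mg bg Ag.
have -> : fine (P A) = \int[P]_x (\1_A x)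
    by rewrite /Rintegral integral_indic// setIT.
apply: le_Rintegral => //; first exact: integrable_bdd bg.
exact: (integrable_bdd _ _ (@bdd_indic A)).
Qed.

Lemma measurable_standardized (B x : R) : measurable [set s : R | s / B < x].
Proof.
have h : measurable_fun setT (fun s : R => s / B) by exact: measurable_funM.
have := h measurableT _ (measurable_itv `]-oo, x[); rewrite setTI.
by congr measurable; apply/seteqP; split => s /=; rewrite in_itv.
Qed.

(** The half-line is sandwiched between the ramps starting at [x - d] and at [x]: the shift costs
    [d] in [Phi], and [12 + 2 / d] is the constant of [clt_lip] for A = 1 and K = 1/d. The bound
    does not depend on [x], so it passes to the supremum; [d] is fixed before n grows. *)
Lemma cdf_dist_le n (x d : R) (B := Bn F n.+1) : 0 < d ->
  `| fine (lawS F n.+1 [set s | s / B < x]) - Phi x |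
    <= d + 2 * (12 + 2 / d) * stein_rate F B.
Proof.
move=> d0; rewrite lawSE; last exact: measurable_standardized.
have mB : measurable_fun setT (fun s : R => s / B) by exact: measurable_funM.
have key y := @clt_lip n (ramp y d) 1 d^-1 (@ramp_bdd y d) (ramp_lip y d0).
have mr y : measurable_fun setT (ramp y d).
  exact: continuous_measurable_fun (lip_continuous (ramp_lip y d0)).
have mrB y : measurable_fun setT (fun s : R => ramp y d (s / B))
    by exact: measurableT_comp.
have brB y : bdd_by 1 (fun s : R => ramp y d (s / B)) by move=> s; exact: ramp_bdd.
have iE (y s : R) : \1_[set s | s / B < y] s = \1_(`]-oo, y[) (s / B) :> R.
  by rewrite !indicE; congr ((nat_of_bool _)%:R); rewrite [RHS]mem_setE in_itv/=.
have mi (y : R) : measurable_fun setT (\1_(`]-oo, y[) : R ->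
    R) by exact: measurable_indic.
rewrite ler_norml; apply/andP; split.
- have h1 : \int[law F n.+1]_s ramp (x - d) d (s / B) <=
    fine (law F n.+1 [set s | s / B < x]).
    apply: (prob_ge_Rintegral _ _ (mrB _) (brB _));
        first exact: measurable_standardized.
    by move=> s; rewrite iE -[x in leRHS](subrK d); exact: ramp_indic_le.
  have h2 : Phi (x - d) <= gauss_mean (ramp (x - d) d).
    rewrite Phi_indic; apply: (gauss_mean_le (mi _) (@bdd_indic _) (mr _)
        (@ramp_bdd _ _)).
    by move=> u; exact: ramp_indic_ge.
  have h3 : Phi x <= Phi (x - d) + d by rewrite -{1}[x](subrK d); apply: Phi_lip;
      exact: ltW.
  have := key (x - d); rewrite ler_norml => /andP[h4 _].
  lra.
- have h1 : fine (law F n.+1 [set s | s / B < x]) <=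
    \int[law F n.+1]_s ramp x d (s / B).
    apply: (prob_le_Rintegral _ _ (mrB _) (brB _));
        first exact: measurable_standardized.
    by move=> s; rewrite iE; exact: ramp_indic_ge.
  have h2 : gauss_mean (ramp x d) <= Phi (x + d).
    rewrite Phi_indic; apply: (gauss_mean_le (mr _) (@ramp_bdd _ _) (mi _)
        (@bdd_indic _)).
    by move=> u; exact: ramp_indic_le.
  have h3 : Phi (x + d) <= Phi x + d by apply: Phi_lip; exact: ltW.
  have := key x; rewrite ler_norml => /andP[_ h4].
  lra.
Qed.

End clt_uniform.

(** * Convergence of Delta and lower bounds of the fractions for g1 *)

Section clt_rate.
Context {R : realType}.
Variable F : probability R R.
Hypothesis hF : calF F.

Lemma Bn_inv_cvg : (Bn F n.+1)^-1 @[n --> \oo] --> (0 : R).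
Proof.
have s0 := sigma1sq_gt0 hF.
apply/cvgrPdist_le => e e0; near=> n.
rewrite sub0r normrN ger0_norm ?invr_ge0 ?Bn_ge0//.
rewrite -[e]invrK lef_pV2 ?posrE ?invr_gt0 ?(Bn_gt0 hF)//.
rewrite -(@ler_pXn2r _ 2) ?nnegrE ?invr_ge0 ?Bn_ge0 ?(ltW e0)//.
rewrite sqr_Bn// -ler_pdivrMr//.
have : e^-1 ^+ 2 / sigma1sq F <= n%:R by near: n; exact: nbhs_infty_ger.
by move=> /le_trans; apply; rewrite ler_nat.
Unshelve. all: by end_near. Qed.

Lemma stein_rate_cvg : stein_rate F (Bn F n.+1) @[n --> \oo] --> (0 : R).
Proof.
have Bc := Bn_inv_cvg.
rewrite -[X in _ --> X]addr0; apply: cvgD; last first.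
  by rewrite -[X in _ --> X](mulr0 (\int[F]_y `|y|)); apply: cvgM => //;
      exact: cvg_cst.
rewrite -[X in _ --> X](mul0r (sigma1sq F)^-1); apply: cvgM; last exact: cvg_cst.
have B0 n : 0 < Bn F n.+1 := Bn_gt0 hF n.
have ab n (y : R) : 0 <= y ^+ 2 * Num.min (`|y| / Bn F n.+1) 1 <= y ^+ 2.
  rewrite mulr_ge0 ?sqr_ge0//= ?ler_piMr ?sqr_ge0 ?ge_min ?lexx ?orbT//.
  by rewrite le_min ler01 divr_ge0// ltW.
have DC : (\int[F]_y (y ^+ 2 * Num.min (`|y| / Bn F n.+1) 1)%:E)%E @[n --> \oo]
    --> (\int[F]_y (cst 0 y))%E.
  apply: (@dominated_cvg _ _ _ F setT measurableT
    (fun n y => (y ^+ 2 * Num.min (`|y| / Bn F n.+1) 1)%:E) (cst 0%E) (fun y =>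
        (y ^+ 2)%:E)).
  - by move=> n; apply: measurable_int (integrable_trunc hF (B0 n)).
  - move=> y _; apply: cvg_EFin; first exact: nearW.
    apply: (@squeeze_cvgr _ _ _ _ (cst 0) (fun n => y ^+ 2 * (`|y| / Bn F n.+1))).
    + apply: nearW => n /=; have /andP[-> _] := ab n y => /=.
      by rewrite ler_wpM2l ?sqr_ge0// ge_min lexx.
    + exact: cvg_cst.
    + rewrite -[X in _ --> X](mulr0 (y ^+ 2)); apply: cvgM; first exact: cvg_cst.
      by rewrite -[X in _ --> X](mulr0 `|y|); apply: cvgM => //; exact: cvg_cst.
  - by move=> y _.
  - exact: (integrable_sqr hF).
  - move=> n y _ /=; rewrite lee_fin; have /andP[a b] := ab n y;
      rewrite ger0_norm//.
move: DC; rewrite integral0 => DC.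
exact: (fine_cvg DC).
Qed.

Lemma cdf_dist_le_Delta n (x : R) :
  `| fine (lawS F n.+1 [set s | s / Bn F n.+1 < x]) - Phi x | <= Delta F n.+1.
Proof.
apply: ub_le_sup; last by exists x.
(* A real [sup] dominates its elements only if the set is bounded above; here d = 1 provides some
   bound. *)
exists (1 + 2 * (12 + 2 / 1) * stein_rate F (Bn F n.+1)) => _ [y _ <-].
exact: cdf_dist_le.
Qed.

Lemma Delta_ge0 n : 0 <= Delta F n.+1.
Proof. exact: le_trans (normr_ge0 _) (cdf_dist_le_Delta n 0). Qed.

Lemma Delta_cvg : Delta F n.+1 @[n --> \oo] --> (0 : R).
Proof.
apply/cvgrPdist_le => e e0.
have e2 : 0 < e / 2 by rewrite divr_gt0.
pose c := 2 * (12 + 2 / (e / 2)).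
have c0 : 0 < c by rewrite mulr_gt0// addr_gt0// divr_gt0.
have /cvgrPdist_le/(_ (e / 2 / c)) := stein_rate_cvg.
move=> /(_ (divr_gt0 e2 c0)); apply: filterS => n.
rewrite !sub0r !normrN => h; rewrite ger0_norm ?Delta_ge0//.
apply: (@le_trans _ _ (e / 2 + c * stein_rate F (Bn F n.+1))).
  apply: ge_sup; first by eexists; exists 0.
  by move=> _ [y _ <-]; exact: cdf_dist_le.
rewrite [leRHS](splitr e) lerD2l mulrC -ler_pdivlMr//.
exact: le_trans (ler_norm _) h.
Qed.

Lemma mu1E (t : R) : mu1 F t = \int[F]_x (x ^+ 3 * \1_[set y : R | `|y| < t] x).
Proof.
rewrite /mu1 -/(Rintegral F _ _) Rintegral_mkcond; apply: eq_Rintegral => x _.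
by rewrite patchE indicE; case: (_ \in _); rewrite ?mulr1 ?mulr0.
Qed.

Lemma sigma1sqzE (t : R) :
  sigma1sqz F t = \int[F]_x (x ^+ 2 * \1_[set y : R | t <= `|y|] x).
Proof.
rewrite /sigma1sqz -/(Rintegral F _ _) Rintegral_mkcond; apply: eq_Rintegral => x _.
by rewrite patchE indicE; case: (_ \in _); rewrite ?mulr1 ?mulr0.
Qed.

Lemma measurable_abs_lt (t : R) : measurable [set y : R | `|y| < t].
Proof.
have h : measurable_fun setT (fun s : R => `|s|) by exact: measurableT_comp.
have := h measurableT _ (measurable_itv `]-oo, t[); rewrite setTI.
by congr measurable; apply/seteqP; split => s /=; rewrite in_itv.
Qed.

Lemma measurable_abs_ge (t : R) : measurable [set y : R | t <= `|y|].
Proof.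
have h : measurable_fun setT (fun s : R => `|s|) by exact: measurableT_comp.
have := h measurableT _ (measurable_itv `[t, +oo[); rewrite setTI.
by congr measurable; apply/seteqP; split => s /=; rewrite in_itv/= andbT.
Qed.

Lemma integrable_sqr_indic (A : set R) : measurable A ->
  F.-integrable setT (EFin \o (fun x : R => x ^+ 2 * \1_A x)).
Proof.
move=> mA; apply: (le_integrable measurableT _ _ (integrable_sqr hF)).
  apply/measurable_EFinP; apply: measurable_funM => //.
move=> x _ /=; rewrite lee_fin normrM ler_piMr// indicE.
by case: (_ \in _); rewrite ?normr1 ?normr0.
Qed.

Lemma mu1_le (t : R) : 0 <= t -> `|mu1 F t| <= t * sigma1sq F.
Proof.
move=> t0; rewrite mu1E; have mA := measurable_abs_lt t.
have it : F.-integrable setT (EFin \o (fun x : R => t * x ^+ 2)).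
  by have := integrableZl measurableT t (integrable_sqr hF); apply: eq_integrable.
have le3 (x : R) : `|x ^+ 3 * \1_[set y : R | `|y| < t] x| <= t * x ^+ 2.
  rewrite indicE; have [xt|xt] := ltP `|x| t.
    rewrite mem_set// mulr1 normrX exprS (real_normK (num_real x)).
    by rewrite ler_wpM2r ?sqr_ge0// ltW.
  by rewrite memNset /= ?ltNge ?xt// mulr0 normr0 mulr_ge0 ?sqr_ge0.
rewrite /sigma1sq -/(Rintegral F _ _) -RintegralZl//;
    last exact: (integrable_sqr hF).
apply: normr_Rintegral_le => //.
apply: (le_integrable measurableT _ _ it).
  by apply/measurable_EFinP; apply: measurable_funM => //; exact: measurable_funX.
by move=> x _ /=; rewrite lee_fin (le_trans (le3 x))// ler_norm.
Qed.

Lemma sigma1sqz_ge0 (t : R) : 0 <= sigma1sqz F t.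
Proof. by apply: Rintegral_ge0 => x _; exact: sqr_ge0. Qed.

Lemma sigma1sqz_le (t : R) : sigma1sqz F t <= sigma1sq F.
Proof.
rewrite sigma1sqzE; apply: le_Rintegral => //.
- exact: (integrable_sqr_indic (measurable_abs_ge t)).
- exact: (integrable_sqr hF).
- by move=> x _; rewrite indicE; case: (_ \in _); rewrite ?mulr1 ?mulr0 ?sqr_ge0.
Qed.

Lemma sigma1sqz_ge (t : R) : sigma1sq F - t ^+ 2 <= sigma1sqz F t.
Proof.
rewrite lerBlDr sigma1sqzE -[X in _ + X](prob_Rintegral_cst F) -RintegralD//;
    last 2 first.
- exact: (integrable_sqr_indic (measurable_abs_ge t)).
- exact: prob_integrable_cst.
apply: le_Rintegral => //.
- exact: (integrable_sqr hF).
- by have := integrableD measurableT (integrable_sqr_indic (measurable_abs_ge t))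
    (prob_integrable_cst F (t ^+ 2)); apply: eq_integrable.
- move=> x _; rewrite indicE; have [tx|xt] := leP t `|x|.
    by rewrite mem_set// mulr1 lerDl sqr_ge0.
  rewrite memNset /=; last by apply/negP; rewrite -ltNge.
  rewrite mulr0 add0r.
  rewrite -(real_normK (num_real x)) ler_pXn2r ?nnegrE ?(ltW xt)//.
  exact: le_trans (ltW xt).
Qed.

Section at_n.
Variable n : nat.
Let B := Bn F n.+1.
Let B0 : 0 < B := Bn_gt0 hF n.

Lemma n_div_Bn_sqr : n.+1%:R * B ^- 2 * sigma1sq F = 1.
Proof.
rewrite mulrAC -(sqr_Bn hF) -/B divff// expf_neq0// gt_eqF//.
Qed.

Lemma Mn_le (z : R) : 0 <= z -> `|Mn F n.+1 z| <= z.
Proof.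
move=> z0; rewrite /Mn -/B normrM ger0_norm; last first.
  by rewrite mulr_ge0// invr_ge0 exprn_ge0// ltW.
have h : 0 <= n.+1%:R * B ^- 3 by rewrite mulr_ge0// invr_ge0 exprn_ge0// ltW.
rewrite (le_trans (ler_wpM2l h (mu1_le (_ : 0 <= z * B))))//.
  by rewrite mulr_ge0// ltW.
have -> : n.+1%:R * B ^- 3 * (z * B * sigma1sq F) =
    z * (n.+1%:R * B ^- 2 * sigma1sq F).
  by field; rewrite gt_eqF.
by rewrite n_div_Bn_sqr mulr1.
Qed.

Lemma Ln_ge0 (z : R) : 0 <= Ln F n.+1 z.
Proof. by rewrite /Ln mulr_ge0 ?sigma1sqz_ge0// mulr_ge0// invr_ge0 exprn_ge0//
    ltW. Qed.

Lemma Ln_le1 (z : R) : Ln F n.+1 z <= 1.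
Proof.
rewrite -n_div_Bn_sqr /Ln ler_wpM2l ?sigma1sqz_le// mulr_ge0//
    invr_ge0 exprn_ge0// ltW//.
Qed.

(** Values below the level zB carry variance at most (zB)^2, hence at most half of it once (zB)^2 <=
    sigma^2/2. Such a z may depend on n, as the fractions take a supremum over all small z. *)
Lemma exists_Ln_ge (e : R) : 0 < e -> exists2 z, 0 < z < e & 2^-1 <= Ln F n.+1 z.
Proof.
move=> e0; have s0 := sigma1sq_gt0 hF.
pose c := Num.sqrt (sigma1sq F / 2) / B.
have c0 : 0 < c by rewrite divr_gt0// sqrtr_gt0 divr_gt0.
exists (Num.min (e / 2) c).
  by rewrite lt_min c0 divr_gt0//= gt_min ltr_pdivrMr// ltr_pMr// ltr1n.
set z := Num.min _ _.
have z0 : 0 <= z by rewrite le_min ltW//= ?ltW// divr_gt0.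
have h : (z * B) ^+ 2 <= sigma1sq F / 2.
  rewrite -[leRHS]sqr_sqrtr; last by rewrite divr_ge0// ltW.
  rewrite ler_pXn2r ?nnegrE ?sqrtr_ge0 ?mulr_ge0 ?(ltW B0)//.
  by rewrite -ler_pdivlMr// ge_min lexx orbT.
have h2 : sigma1sq F / 2 <= sigma1sqz F (z * B).
  have := sigma1sqz_ge (z * B); lra.
have -> : 2^-1 = n.+1%:R * B ^- 2 * (sigma1sq F / 2)
    by rewrite mulrA n_div_Bn_sqr mul1r.
by rewrite /Ln ler_wpM2l// mulr_ge0// invr_ge0 exprn_ge0// ltW.
Qed.

Lemma g1_ratio (z : R) : g1 B (z * B) / g1 B B = Num.max z 1.
Proof.
rewrite /g1 maxxx -{2}[B]mul1r -maxr_pMl ?ltW// mulfK// gt_eqF//.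
Qed.

Lemma LE_g1_ge (e gam : R) : 0 < e -> 0 < gam -> 2^-1 <= LE F (@g1 R) e gam n.+1.
Proof.
move=> e0 gam0; have [z /andP[z0 ze] hz] := exists_Ln_ge e0.
have E y : g1 B (y * B) / (y * g1 B B) = Num.max y 1 / y.
  by rewrite invfM [y^-1 * _]mulrC mulrA g1_ratio.
have m1 (y : R) : 1 <= Num.max y 1 by rewrite le_max lexx orbT.
apply: (@le_trans _ _ (g1 B (z * B) / (z * g1 B B) * (gam * `|Mn F n.+1 z| + z *
    Ln F n.+1 z))).
  rewrite E (le_trans hz)// -mulrA -[leLHS]mul1r ler_pM ?Ln_ge0//.
  rewrite ler_pdivlMl// lerDr mulr_ge0// ltW//.
apply: ub_le_sup; last by exists z => //=; rewrite in_itv/= z0.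
(* Boundedness of the set, from [|M_n(z)| <= z] and [L_n(z) <= 1]: the factor 1/z is absorbed by
   both terms. *)
exists (Num.max e 1 * (gam + 1)) => w [y]; rewrite /= in_itv/= => /andP[y0 ye] <-.
rewrite -/B E -mulrA ler_pM//.
- by rewrite (le_trans _ (m1 y)).
- by rewrite mulr_ge0 ?invr_ge0 ?(ltW y0)// addr_ge0//
    mulr_ge0 ?Ln_ge0 ?(ltW y0)// ltW.
- by rewrite ge_max !le_max (ltW ye) lexx orbT.
- rewrite ler_pdivrMl// mulrDr mulr1 lerD//.
    by rewrite mulrC ler_wpM2r ?(ltW gam0)// Mn_le ?ltW.
  by rewrite ler_piMr ?Ln_le1 ?ltW.
Qed.

Lemma LR_g1_ge (e gam : R) : 0 < e -> 0 < gam -> 2^-1 <= LR F (@g1 R) e gam n.+1.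
Proof.
move=> e0 gam0; have [z /andP[z0 ze] hz] := exists_Ln_ge e0.
have m1 (y : R) : 1 <= Num.max y 1 by rewrite le_max lexx orbT.
rewrite /LR -/B; apply: ler_wpDl.
  rewrite mulr_ge0// mulr_ge0 ?(ltW gam0)// divr_ge0//.
    by rewrite le_max (ltW B0) orbT.
  by rewrite mulr_ge0 ?(ltW e0)// le_max (ltW B0) orbT.
apply: (@le_trans _ _ (g1 B (z * B) / g1 B B * Ln F n.+1 z)).
  by rewrite g1_ratio (le_trans hz)// -[leLHS]mul1r ler_pM ?Ln_ge0.
apply: ub_le_sup; last by exists z => //=; rewrite in_itv/= z0.
exists (Num.max e 1) => w [y]; rewrite /= in_itv/= => /andP[y0 ye] <-.
rewrite g1_ratio -[leRHS]mulr1 ler_pM ?Ln_ge0 ?Ln_le1//.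
- by rewrite (le_trans _ (m1 y)).
- by rewrite ge_max !le_max (ltW ye) lexx orbT.
Qed.

End at_n.

Lemma limn_esup_ratio0 (L : nat -> R) : (forall n, 2^-1 <= L n.+1) ->
  limn_esup (fun n => (Delta F n / L n)%:E) = 0%E.
Proof.
move=> L2; apply: (cvg_limn_einf_sup _).2.
rewrite -cvg_shiftS/=.
apply: cvg_EFin; first exact: nearW.
apply: (@squeeze_cvgr _ _ _ _ (cst 0) (fun n => 2 * Delta F n.+1)).
- apply: nearW => n /=; have L0 : 0 < L n.+1 by rewrite (lt_le_trans _ (L2 n)).
  rewrite divr_ge0 ?Delta_ge0 ?(ltW L0)//= mulrC ler_wpM2r ?Delta_ge0//.
  by rewrite invf_ple ?posrE.
- exact: cvg_cst.
- by rewrite -[X in _ --> X](mulr0 2); apply: cvgM;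
    [exact: cvg_cst|exact: Delta_cvg].
Qed.

End clt_rate.

(** * Taylor expansions of the Mills ratio *)

Section mills_expansion.
Context {R : realType}.
Notation mu := (@lebesgue_measure R).
Implicit Types (x y u v : R).

(** [mills1] and [mills2] are the first two derivatives of the Mills ratio, closed in M thanks to M'
    = x M - 1. *)
Definition mills1 x : R := x * mills x - 1.
Definition mills2 x : R := mills x + x * mills1 x.

Lemma is_derive_mills1 x : is_derive x 1 mills1 (mills2 x).
Proof.
have h := is_derive_mills x; rewrite /mills1 /mills2 -/(mills1 x).
by apply: is_derive_eq; rewrite /GRing.scale/= /mills1; ring.
Qed.

Lemma is_derive_mills2 x : is_derive x 1 mills2 (2 * mills1 x + x * mills2 x).
Proof.
have h := is_derive_mills x; have h1 := is_derive_mills1 x; rewrite /mills2.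
by apply: is_derive_eq; rewrite /GRing.scale/= /mills2 /mills1; ring.
Qed.

(** All of these rephrase x/(1+x^2) <= M(x) <= 1/x together with M <= 2; for instance [mills2 x] is
    (1+x^2) M(x) - x. *)
Lemma mills_bounds x : 0 <= x ->
  [/\ - 1 <= mills1 x <= 0, 0 <= mills2 x <= 2, `|x * mills1 x| <=
      1 & `|x * mills2 x| <= 1].
Proof.
move=> x0; have a := mul_mills_le1 x0; have b := mills_le2 x0;
    have c := mills_ge0 x.
have d := onem_mul_mills_le x0; have e := mills_ge x0.
have f : 0 <= x * mills x by rewrite mulr_ge0.
have g : 0 <= 1 - x * mills x by rewrite subr_ge0.
have h : 0 <= x * (1 - x * mills x) by rewrite mulr_ge0.
have i : 0 <= x ^+ 2 * (1 - x * mills x) by rewrite mulr_ge0 ?sqr_ge0.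
rewrite /mills2 /mills1; split.
- by apply/andP; split; lra.
- by apply/andP; split; nra.
- by rewrite ler_norml; apply/andP; split; nra.
- by rewrite ler_norml; apply/andP; split; nra.
Qed.

Lemma itv_ge0 u v z : 0 <= u -> 0 <= v -> Num.min u v <= z -> 0 <= z.
Proof. by move=> u0 v0; apply: le_trans; rewrite le_min u0. Qed.

Lemma dist_le_is_derive_sym (f df : R -> R) C u v :
  (forall z, Num.min u v <= z <= Num.max u v -> is_derive z 1 f (df z)) ->
  (forall z, Num.min u v <= z <= Num.max u v -> `|df z| <= C) ->
  `|f v - f u| <= C * `|v - u|.
Proof.
have [uv|vu] := leP u v => fd dC.
- by rewrite [X in _ * X]ger0_norm ?subr_ge0//; exact: (dist_le_is_derive uv).
- rewrite distrC [X in _ * X]distrC [X in _ * X]ger0_norm ?subr_ge0 ?(ltW vu)//.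
  exact: (dist_le_is_derive (ltW vu)).
Qed.

Lemma itv_dist u v z : Num.min u v <= z <= Num.max u v -> `|z - u| <= `|v - u|.
Proof.
have [uv|/ltW vu] := leP u v => /andP[a b].
- by rewrite !ger0_norm ?subr_ge0// lerB.
- by rewrite !ler0_norm ?subr_le0// !opprB lerB.
Qed.

Lemma min_le_itv u v z : Num.min u v <= z <= Num.max u v -> 0 <= u -> 0 <= v ->
    0 <= z.
Proof. by move=> /andP[h _] u0 v0; exact: itv_ge0 h. Qed.

Lemma mills2_lip u v : 0 <= u -> 0 <= v -> `|mills2 v - mills2 u| <= 3 * `|v - u|.
Proof.
move=> u0 v0; apply: (dist_le_is_derive_sym (fun z _ => is_derive_mills2 z)) =>
    z zuv.
have z0 := min_le_itv zuv u0 v0.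
have [/andP[a b] _ _ d] := mills_bounds z0.
rewrite (le_trans (ler_normD _ _))// normrM ger0_norm// ler0_norm//; lra.
Qed.

Lemma mills1_taylor u v : 0 <= u -> 0 <= v ->
  `|mills1 v - mills1 u - (v - u) * mills2 u| <= 3 * `|v - u| ^+ 2.
Proof.
move=> u0 v0; pose f z := mills1 z - z * mills2 u.
have -> : mills1 v - mills1 u - (v - u) * mills2 u = f v - f u by rewrite /f; ring.
rewrite expr2 mulrA; apply: (@dist_le_is_derive_sym _ (fun z =>
    mills2 z - mills2 u)) => z zuv.
  have h := is_derive_mills1 z; apply: is_derive_eq; rewrite /GRing.scale/=; ring.
have z0 := min_le_itv zuv u0 v0.
by rewrite (le_trans (mills2_lip u0 z0))// ler_wpM2l// itv_dist.
Qed.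

(** The derivative of each remainder in its endpoint is the remainder of the preceding order, so the
    constant 3 of [mills2_lip] is carried along, without the gain of a factorial. *)
Lemma mills_taylor u v : 0 <= u -> 0 <= v ->
  `|mills v - mills u - (v - u) * mills1 u - (v - u) ^+ 2 / 2 * mills2 u| <=
      3 * `|v - u| ^+ 3.
Proof.
move=> u0 v0; pose f z := mills z - z * mills1 u - (z - u) ^+ 2 / 2 * mills2 u.
have -> : mills v - mills u - (v - u) * mills1 u - (v - u) ^+ 2 / 2 * mills2 u =
    f v - f u.
  by rewrite /f; field.
rewrite exprSr mulrA.
apply: (@dist_le_is_derive_sym _ (fun z =>
    mills1 z - mills1 u - (z - u) * mills2 u)) => z zuv.
  by have h := is_derive_mills z; apply: is_derive_eq;
      rewrite /GRing.scale/= /mills1; field.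
have z0 := min_le_itv zuv u0 v0.
rewrite (le_trans (mills1_taylor u0 z0))// ler_wpM2l// ler_pXn2r ?nnegrE//.
exact: itv_dist.
Qed.

(** Here the factor u may be large, and the bound must not depend on it: u [mills2] z is compared
    with z [mills2] z, which is bounded, at the cost of |z - u| [mills2] z. This handles the term of
    [sign_remainder] carrying an explicit factor x. *)
Lemma mul_mills1_lip u v : 0 <= u -> 0 <= v ->
    `|u * (mills1 v - mills1 u)| <= (1 + 2 * `|v - u|) * `|v - u|.
Proof.
move=> u0 v0; rewrite mulrBr.
apply: (@dist_le_is_derive_sym (fun z => u * mills1 z) (fun z =>
    u * mills2 z)) => z zuv.
  have h := is_derive_mills1 z; apply: is_derive_eq; rewrite /GRing.scale/=; ring.
have z0 := min_le_itv zuv u0 v0.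
have [_ /andP[a b] _ d] := mills_bounds z0.
have -> : u * mills2 z = z * mills2 z - (z - u) * mills2 z by ring.
rewrite (le_trans (ler_normB _ _))// lerD// normrM mulrC ler_pM//.
  by rewrite ger0_norm.
exact: itv_dist.
Qed.

Lemma mul_mills_taylor u v : 0 <= u -> 0 <= v ->
  `|u * (mills v - mills u - (v - u) * mills1 u)| <=
      (1 + 2 * `|v - u|) * `|v - u| ^+ 2.
Proof.
move=> u0 v0; pose f z := u * (mills z - z * mills1 u).
have -> : u * (mills v - mills u - (v - u) * mills1 u) = f v - f u by rewrite /f;
    ring.
rewrite expr2 mulrA.
apply: (@dist_le_is_derive_sym _ (fun z => u * (mills1 z - mills1 u))) => z zuv.
  have h := is_derive_mills z; apply: is_derive_eq;
      rewrite /GRing.scale/= /mills1; ring.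
have z0 := min_le_itv zuv u0 v0; have zu := itv_dist zuv.
rewrite (le_trans (mul_mills1_lip u0 z0))//.
by rewrite ler_pM// ?lerD2l ?ler_wpM2l// addr_ge0// mulr_ge0.
Qed.

(* [h * skew_corr p] is the part of order [h] of [sign_remainder p h] below. *)
Definition skew_corr (p x : R) : R := mills2 `|x| / 2 - p * (`|x| * mills1 `|x|).

Lemma skew_corr_bdd p : 0 <= p <= 1 -> bdd_by 2 (skew_corr p).
Proof.
move=> /andP[p0 p1] x; have [_ /andP[a b] c _] := mills_bounds (normr_ge0 x).
rewrite /skew_corr; have d : `|p * (`|x| * mills1 `|x|)| <= 1.
  by rewrite normrM (ger0_norm p0) mulr_ile1.
rewrite (le_trans (ler_normB _ _))// ger0_norm; lra.
Qed.

Lemma skew_corr_ge0 p x : 0 <= p -> 0 <= skew_corr p x.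
Proof.
move=> p0; have [/andP[_ a] /andP[b _] _ _] := mills_bounds (normr_ge0 x).
by rewrite /skew_corr subr_ge0 (@le_trans _ _ 0) ?divr_ge0// mulr_ge0_le0//
    mulr_ge0_le0.
Qed.

Lemma skew_corr_lip p : 0 <= p <= 1 -> lip_by 4 (skew_corr p).
Proof.
move=> /andP[p0 p1] x y; rewrite /skew_corr distrC.
apply: (@le_trans _ _ (4 * normr (`|y| - `|x|))); last first.
  by rewrite ler_wpM2l// distrC; exact: ler_dist_dist.
pose f z := mills2 z / 2 - p * (z * mills1 z).
rewrite -/(f `|y|) -/(f `|x|).
apply: (@dist_le_is_derive_sym f (fun z =>
    (2 * mills1 z + z * mills2 z) / 2 - p * (mills1 z + z * mills2 z))) => z zuv.
  have h1 := is_derive_mills1 z; have h2 := is_derive_mills2 z.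
  apply: is_derive_eq; rewrite /GRing.scale/=; ring.
have z0 := min_le_itv zuv (normr_ge0 _) (normr_ge0 _).
have [/andP[a b] _ _ ] := mills_bounds z0; rewrite ler_norml => /andP[c d].
rewrite ler_norml; apply/andP; split; nra.
Qed.

(* Integrating by parts removes the factors [gauss_tail] of [skew_corr p *
    gauss]. *)
Definition skew_prim (p x : R) : R :=
  ((x + x ^+ 3 / 3) * gauss_tail x - (x ^+ 2 + 2) / 3 * gauss x) / 2
  + p * ((x ^+ 2 - 1) / 3 * gauss x - x ^+ 3 / 3 * gauss_tail x).

Lemma is_derive_skew_prim p x : 0 <= x ->
    is_derive x 1 (skew_prim p) (skew_corr p x * gauss x).
Proof.
move=> x0; have h1 := is_derive_gauss_tail x; have h2 := is_derive_gauss x.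
rewrite /skew_corr ger0_norm// /mills2 /mills1 /mills.
apply: is_derive_eq; rewrite /GRing.scale/=; field; exact: gauss_neq0.
Qed.

Lemma cvg_skew_prim p : 0 <= p <= 1 -> skew_prim p x @[x --> +oo] --> (0 : R).
Proof.
move=> /andP[p0 p1].
apply/cvgrPdist_le => e e0; near=> x.
have x1 : 1 <= x by near: x; exact: nbhs_pinfty_ge.
(* 48 = 3 * 16: the primitive is at most 3 x^2 gauss(x) in absolute value, and x^3 gauss(x) <= x^4
   gauss(x) <= 16. *)
have xe : 48 / e <= x by near: x; apply: nbhs_pinfty_ge; exact: num_real.
have x0 : 0 <= x by lra.
rewrite sub0r normrN.
have a := expr4_gauss_le x; have b := mul_gauss_tail_le x0;
    have c := gauss_ge0 x; have d := gauss_tail_ge0 x.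
have g0 : 0 <= x ^+ 2 * gauss x by rewrite mulr_ge0 ?sqr_ge0.
have g1 : gauss x <= x ^+ 2 * gauss x by rewrite ler_peMl// exprn_ege1.
have g2 : x ^+ 3 * gauss_tail x <= x ^+ 2 * gauss x
    by rewrite exprSr -mulrA ler_wpM2l ?sqr_ge0.
have g3 : 0 <= x ^+ 3 * gauss_tail x by rewrite mulr_ge0// exprn_ge0.
have g4 : 0 <= x * gauss_tail x by rewrite mulr_ge0.
have h1 : `|skew_prim p x| <= 3 * (x ^+ 2 * gauss x).
  have -> : skew_prim p x = (x * gauss_tail x + x ^+ 3 * gauss_tail x / 3 - (x ^+
      2 * gauss x + 2 * gauss x) / 3) / 2
     + p * ((x ^+ 2 * gauss x - gauss x) / 3 - x ^+ 3 * gauss_tail x / 3)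
         by rewrite /skew_prim; field.
  rewrite (le_trans (ler_normD _ _))//.
  have t1 : `|(x * gauss_tail x + x ^+ 3 * gauss_tail x / 3 - (x ^+ 2 * gauss x +
      2 * gauss x) / 3) / 2| <= 2 * (x ^+ 2 * gauss x).
    by rewrite ler_norml; apply/andP; split; lra.
  have t2 : `|(x ^+ 2 * gauss x - gauss x) / 3 - x ^+ 3 * gauss_tail x / 3| <=
      x ^+ 2 * gauss x.
    by rewrite ler_norml; apply/andP; split; lra.
  have : `|p * ((x ^+ 2 * gauss x - gauss x) / 3 - x ^+ 3 * gauss_tail x / 3)| <=
      x ^+ 2 * gauss x.
    by rewrite normrM (ger0_norm p0) (le_trans _ t2)// ler_piMl.
  lra.
have h2 : x * (x ^+ 2 * gauss x) <= 16.
  apply: le_trans a; rewrite mulrA -exprS ler_wpM2r//.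
  by rewrite ler_weXn2l.
rewrite (le_trans h1)// -(@ler_pM2l _ x); last lra.
have : 48 <= x * e by rewrite -ler_pdivrMr.
lra.
Unshelve. all: by end_near. Qed.

(** The coefficients of [gauss_tail] vanish at 0, leaving -1/3 from the first bracket and -p/3 from
    the second. This is the origin of the factor (1+p)/3 in the bounds. *)
Lemma skew_prim0 p : skew_prim p 0 = - (1 + p) / 3.
Proof.
have e : gauss (0 : R) = 1 by rewrite /gauss expr0n/= mul0r oppr0 expR0.
by rewrite /skew_prim e !expr0n/=; field.
Qed.

Lemma gauss_mean_skew_corr p : 0 <= p <= 1 ->
  gauss_mean (skew_corr p) = 2 * (1 + p) / (3 * Num.sqrt (2 * pi)).
Proof.
move=> p01; have /andP[p0 p1] := p01.
have ck : continuous (skew_corr p) := lip_continuous (skew_corr_lip p01).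
have ckg : continuous (fun x => skew_corr p x * gauss x).
  by move=> x; apply: continuousM; [exact: ck|exact: continuous_gauss].
have h : (\int[mu]_x (skew_corr p x * gauss x)%:E = (2 * ((1 + p) / 3))%:E)%E.
  rewrite (@ge0_symfun_integralT _ (fun x => skew_corr p x * gauss x))//;
      last 2 first.
  - by move=> x; rewrite mulr_ge0 ?gauss_ge0 ?skew_corr_ge0.
  - by move=> x /=; rewrite gaussN /skew_corr normrN.
  rewrite EFinM; congr (_ * _)%E; rewrite -set_itvcy.
  rewrite (@ge0_continuous_FTC2y _ _ (skew_prim p) _ 0).
  - by rewrite skew_prim0 -EFinB; congr EFin; field.
  - by move=> x _; rewrite mulr_ge0 ?gauss_ge0 ?skew_corr_ge0.
  - exact: continuous_subspaceT.
  - exact: cvg_skew_prim.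
  - by move=> x x0; case: (is_derive_skew_prim p (ltW x0)).
  - by apply: cvg_at_right_filter;
      exact: is_derive_continuous (is_derive_skew_prim p (lexx 0)).
  - move=> x; rewrite in_itv/= andbT => x0; rewrite derive1E.
    by have [_ ->] := is_derive_skew_prim p (ltW x0).
rewrite /gauss_mean /Rintegral h/=; field.
by rewrite gt_eqF// sqrt2pi_gt0.
Qed.

End mills_expansion.

(** * Two-point laws *)

Section two_point.
Context {R : realType}.

Definition two_point_map (p : R) (b : bool) : R := if b then 1 - p else - p.

Lemma measurable_two_point_map p : measurable_fun setT (two_point_map p).
Proof. by []. Qed.

HB.instance Definition _ p := @isMeasurableFun.Build _ _ _ _ (two_point_map p)
    (measurable_two_point_map p).

Definition two_point (p : R) : probability R R :=
  distribution (bernoulli_prob p) (two_point_map p).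

Variable p : R.
Hypothesis p01 : 0 < p < 1.
Let F := two_point p.
Let q := 1 - p.

Let p0 : 0 < p. Proof. by case/andP: p01. Qed.
Let p1 : p < 1. Proof. by case/andP: p01. Qed.
Let q0 : 0 < q. Proof. by rewrite subr_gt0. Qed.

Lemma two_point_ge0_integral (f : R -> \bar R) : measurable_fun setT f ->
    (forall x, 0 <= f x)%E ->
  (\int[two_point p]_x f x = p%:E * f (1 - p)%R + (1 - p)%:E * f (- p)%R)%E.
Proof.
move=> mf f0; rewrite ge0_integral_distribution//.
have p01' : 0 <= p <= 1 by rewrite !ltW.
exact: (integral_bernoulli_prob p01' (fun b => f0 (two_point_map p b))).
Qed.

Lemma two_point_integrable (g : R -> R) : measurable_fun setT g ->
  F.-integrable setT (EFin \o g).
Proof.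
move=> mg; apply/integrableP; split; first exact/measurable_EFinP.
rewrite two_point_ge0_integral//=; last by do 2 apply: measurableT_comp => //.
by rewrite -!EFinM -EFinD ltry.
Qed.

Lemma two_point_Rintegral (g : R -> R) : measurable_fun setT g ->
  \int[F]_x g x = p * g (1 - p) + (1 - p) * g (- p).
Proof.
(* Reduction to a nonnegative integrand: [h] is nonnegative everywhere and agrees with [g + c] at
   the two atoms. *)
move=> mg; pose c := `|g (1 - p)| + `|g (- p)|.
pose h x := Num.max 0 (g x + c).
have mh : measurable_fun setT h.
  by apply: measurable_maxr => //; exact: measurable_funD.
have hE x : x = 1 - p \/ x = - p -> h x = g x + c.
  move=> xE; rewrite /h max_r// /c.
  have := ler_norm (- g (1 - p)); have := ler_norm (- g (- p)); rewrite !normrN.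
  have := normr_ge0 (g (1 - p)); have := normr_ge0 (g (- p)).
  by case: xE => ->; lra.
have e1 : \int[F]_x h x = p * (g (1 - p) + c) + (1 - p) * (g (- p) + c).
  rewrite /Rintegral two_point_ge0_integral//=.
  - by rewrite !hE; [|by right|by left].
  - exact/measurable_EFinP.
  - by move=> x; rewrite lee_fin le_max lexx.
have e2 : \int[F]_x (g x - (h x - c)) = 0.
  apply/eqP; rewrite -normr_le0.
  have mk : measurable_fun setT (fun x => g x - (h x - c)).
    by apply: measurable_funB => //; exact: measurable_funB.
  rewrite (le_trans (le_normr_Rintegral _ _))//; first exact: two_point_integrable.
  rewrite /Rintegral two_point_ge0_integral//=.
  - by rewrite !hE; [rewrite !addrK !subrr !normr0 !mulr0 addr0|by right|by left].
  - by apply/measurable_EFinP; exact: measurableT_comp.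
move: e2; rewrite RintegralB//; last 2 first.
- exact: two_point_integrable.
- by apply: two_point_integrable; exact: measurable_funB.
rewrite RintegralB//; [|exact: two_point_integrable|exact: prob_integrable_cst].
rewrite e1 prob_Rintegral_cst => /eqP; rewrite subr_eq0 => /eqP ->; ring.
Qed.

Lemma two_point_sigma : sigma1sq F = p * (1 - p).
Proof.
rewrite /sigma1sq -/(Rintegral F _ _) (two_point_Rintegral (g := fun x =>
    x ^+ 2)); last exact: measurable_funX.
ring.
Qed.

Lemma two_point_calF : calF F.
Proof.
split; last split.
- rewrite two_point_ge0_integral ?lee_fin//.
  + by rewrite -!EFinM -EFinD ltry.
  + by apply/measurable_EFinP; exact: measurable_funX.
  + by move=> x; rewrite lee_fin sqr_ge0.
- have it : F.-integrable setT (EFin \o (@idfun R))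
    by apply: two_point_integrable; exact: measurable_id.
  rewrite -[LHS]fineK; last exact: (integrable_fin_num measurableT it).
  congr EFin; rewrite -/(Rintegral F _ _) (two_point_Rintegral (g := idfun)) /=;
      [ring|exact: measurable_id].
- move=> [a Fa].
  have : \int[F]_x \1_[set a] x = 1.
    by rewrite /Rintegral integral_indic// setIT; exact: (congr1 fine Fa).
  have mi : measurable_fun setT (\1_[set a] : R -> R) by exact: measurable_indic.
  rewrite (two_point_Rintegral mi).
  rewrite !indicE !in_set1.
  case: eqP => [h1|_]; case: eqP => [h2|_] /=; rewrite ?mulr1 ?mulr0 ?addr0 ?add0r.
  + by move: h1; rewrite -h2; lra.
  + by move=> e; have := p1; rewrite e ltxx.
  + by move=> e; have := p0; lra.
  + by move=> /eqP; rewrite eq_sym oner_eq0.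
Qed.

Lemma two_point_Bn n : Bn F n ^+ 2 = n%:R * (p * (1 - p)).
Proof. by rewrite (sqr_Bn two_point_calF) two_point_sigma. Qed.

Let Fm : fin_mean F := calF_fin_mean two_point_calF.

Lemma two_point_law n (g : R -> R) a : measurable_fun setT g ->
  (forall x, `|g x| <= a * (1 + `|x|)) ->
  \int[law F n.+1]_x g x = \int[law F n]_z (p * g (z + (1 - p)) + (1 - p) * g (z
      - p)).
Proof.
move=> mg ga; rewrite (law_Rintegral Fm n mg ga); apply: eq_Rintegral => z _.
rewrite (two_point_Rintegral (g := fun y => g (z + y)))//.
by apply: measurableT_comp => //; exact: measurable_funD.
Qed.

Lemma shift_measurable (g : R -> R) c : measurable_fun setT g ->
  measurable_fun setT (fun x : R => g (x + c)).
Proof. by move=> mg; apply: measurableT_comp => //; exact: measurable_funD. Qed.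

(** The induction tracks the support: the steps 1-p and -p lead from j - np to (j+1) - (n+1)p and to
    j - (n+1)p. Inequalities thus have to be checked at lattice points only, and the binomial law
    never has to be written down. *)
Lemma two_point_lattice_le n (g h : R -> R) a : measurable_fun setT g ->
    measurable_fun setT h ->
  (forall x, `|g x| <= a * (1 + `|x|)) -> (forall x, `|h x| <= a * (1 + `|x|)) ->
  (forall j : nat, g (j%:R - n%:R * p) <= h (j%:R - n%:R * p)) ->
  \int[law F n]_x g x <= \int[law F n]_x h x.
Proof.
elim: n g h a => [|n IH] g h a mg mh ga ha gh.
  by rewrite !dirac_Rintegral//; have := gh 0%N; rewrite mul0r subr0.
have a0 : 0 <= a by have := le_trans (normr_ge0 _) (ga 0);
    rewrite normr0 addr0 mulr1.
have gr (f : R -> R) : (forall x, `|f x| <= a * (1 + `|x|)) ->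
    forall x, `|p * f (x + (1 - p)) + (1 - p) * f (x - p)| <= (2 * a) * (1 + `|x|).
  move=> fa x; rewrite (le_trans (ler_normD _ _))//
      !normrM (ger0_norm (ltW p0)) (ger0_norm (ltW q0)).
  have t c : `|c| <= 1 -> `|f (x + c)| <= 2 * a * (1 + `|x|).
    move=> c1; rewrite (le_trans (fa _))// [2 * a]mulrC -mulrA ler_wpM2l//.
    have := ler_normD x c; have := normr_ge0 x; lra.
  have -> : 2 * a * (1 + `|x|) = p * (2 * a * (1 + `|x|)) + (1 - p) * (2 * a * (1
      + `|x|)) by ring.
  rewrite lerD// ler_wpM2l ?(ltW p0) ?(ltW q0)//; apply: t.
    by rewrite ger0_norm ?(ltW q0)// lerBlDr lerDl ltW.
  by rewrite normrN ger0_norm ltW.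
have ms (f : R -> R) : measurable_fun setT f ->
    measurable_fun setT (fun x : R => p * f (x + (1 - p)) + (1 - p) * f (x - p)).
  by move=> mf; apply: measurable_funD; apply: measurable_funM => //;
      exact: shift_measurable.
rewrite (two_point_law _ mg ga) (two_point_law _ mh ha).
(* Averaging over one step moves the argument by at most 1, which at most doubles the growth
   constant. *)
apply: (IH _ _ (2 * a)); [exact: ms|exact: ms|exact: gr|exact: gr|move=> j].
rewrite lerD// ler_wpM2l ?(ltW p0) ?(ltW q0)//.
- have := gh j.+1; rewrite -!natr1.
  by have -> : j%:R + 1 - (n%:R + 1) * p = j%:R - n%:R * p + (1 - p) by ring.
- have := gh j; rewrite -!natr1.
  by have -> : j%:R - (n%:R + 1) * p = j%:R - n%:R * p - p by ring.
Qed.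

(** Exchangeability turns the left side into differences of p f(t+1) + (1-p) f(t) between the points
    z - p and z + (1-p), one unit apart. With these weights the differences are exactly the mean of
    f(t+1) - f(t) over one more two-point step, so no remainder occurs. *)
Lemma two_point_stein n (f : R -> R) A : measurable_fun setT f -> bdd_by A f ->
  \int[law F n.+1]_t (t * (p * f (t + 1) + (1 - p) * f t)) =
  n.+1%:R * (p * (1 - p)) * \int[law F n.+1]_t (f (t + 1) - f t).
Proof.
move=> mf bf; have A0 := bdd_ge0 bf.
pose g t := p * f (t + 1) + (1 - p) * f t.
have mg : measurable_fun setT g.
  by apply: measurable_funD; apply: measurable_funM => //; exact: shift_measurable.
have bg : bdd_by A g.
  move=> t; rewrite (le_trans (ler_normD _ _))//
      !normrM (ger0_norm (ltW p0)) (ger0_norm (ltW q0)).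
  have -> : A = p * A + (1 - p) * A by ring.
  by rewrite lerD// ler_wpM2l ?(ltW p0) ?(ltW q0).
have md : measurable_fun setT (fun t : R => f (t + 1) - f t).
  by apply: measurable_funB => //; exact: shift_measurable.
have gd (t : R) : `|f (t + 1) - f t| <= (2 * A) * (1 + `|t|).
  have := ler_normB (f (t + 1)) (f t); have := bf (t + 1); have := bf t.
  have := normr_ge0 t; nra.
rewrite -/(g _) (law_swap Fm n mg bg) (two_point_law _ md gd) -!mulrA;
    congr (_ * _).
have md2 : measurable_fun setT (fun z : R =>
    p * (f (z + (1 - p) + 1) - f (z + (1 - p))) + (1 - p) * (f (z - p + 1) - f (z
    - p))).
  by apply: measurable_funD; apply: measurable_funM => //;
      exact: (shift_measurable _ md).
rewrite mulrA -RintegralZl//; last first.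
  apply: (@integrable_bdd _ _ _ (2 * A)) => // z.
  rewrite (le_trans (ler_normD _ _))//
      !normrM (ger0_norm (ltW p0)) (ger0_norm (ltW q0)).
  have -> : 2 * A = p * (2 * A) + (1 - p) * (2 * A) by ring.
  have t c d : `|f c - f d| <= 2 * A.
    by have := ler_normB (f c) (f d); have := bf c; have := bf d; lra.
  by rewrite lerD// ler_wpM2l ?(ltW p0) ?(ltW q0).
apply: eq_Rintegral => z _.
rewrite (two_point_Rintegral (g := fun y => y * g (z + y))); last first.
  apply: measurable_funM => //; apply: measurableT_comp => //;
      exact: measurable_funD.
rewrite /g; have -> : z - p + 1 = z + (1 - p) by ring.
ring.
Qed.

End two_point.

(** * Stein's equation for the sign function *)

Section sign_expansion.
Context {R : realType}.
Implicit Types (p h x : R).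

(* [stein_sign] solves Stein's equation for the sign function: its derivative
   minus [x * stein_sign x] is [1] for [x > 0] and [-1] for [x < 0]. *)
Definition stein_sign x : R := - mills `|x|.

(* The sign (equal to 1 at 0) plus terms whose sum has mean zero under
   two-point laws, see [two_point_stein]. *)
Definition sign_remainder p h x : R :=
  1 - 2 * (x < 0)%R%:R + x * stein_sign x - (stein_sign (x + h) - stein_sign x) / h
  + p * x * (stein_sign (x + h) - stein_sign x).

Lemma stein_sign_bdd : bdd_by 2 stein_sign.
Proof. by move=> x; rewrite normrN ger0_norm ?mills_ge0// mills_le2. Qed.

Lemma measurable_stein_sign : measurable_fun setT stein_sign.
Proof.
apply: measurableT_comp => //; apply: measurableT_comp => //.
by apply: continuous_measurable_fun => x;
    exact: is_derive_continuous (is_derive_mills x).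
Qed.

(* [stein_sign] has a kink at 0, so the step from [x] to [x + h] must not cross
   it; lattice points never do when [n p] is an integer. *)
Lemma sign_remainderE p h x : 0 <= p <= 1 -> 0 < h <= 1 -> 0 <= x \/ x <= - h ->
  `|sign_remainder p h x - h * skew_corr p x| <= 6 * h ^+ 2.
Proof.
move=> /andP[p0 p1] /andP[h0 h1] xh.
have hn : h != 0 by rewrite gt_eqF.
(* [r2] is the remainder of the difference quotient and [r1] that of the term with the factor x. As
   h <= 1, each contributes at most 3 h^2. *)
have bound (r1 r2 s : R) : `|r1| <= (1 + 2 * h) * h ^+ 2 ->
    `|r2| <= 3 * h ^+ 3 -> `|s| <= 1 ->
    `|r2 / h + s * r1| <= 6 * h ^+ 2.
  move=> b1 b2 s1.
  have c1 : `|r2 / h| <= 3 * h ^+ 2.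
    by rewrite normrM normfV (gtr0_norm h0) ler_pdivrMr// -mulrA -exprSr.
  have c2 : `|s * r1| <= 3 * h ^+ 2.
    rewrite normrM -[leRHS]mul1r ler_pM//; apply: (le_trans b1).
    by rewrite ler_wpM2r ?sqr_ge0//; lra.
  by rewrite (le_trans (ler_normD _ _))//; lra.
have dist u v : `|v - u| = h -> 0 <= u -> 0 <= v ->
    `|u * (mills v - mills u - (v - u) * mills1 u)| <= (1 + 2 * h) * h ^+ 2 /\
    `|mills v - mills u - (v - u) * mills1 u - h ^+ 2 / 2 * mills2 u| <= 3 * h ^+ 3.
  move=> vu u0 v0; split; first by rewrite -{1 2}vu; exact: mul_mills_taylor.
  have <- : (v - u) ^+ 2 = h ^+ 2 by rewrite -vu real_normK ?num_real.
  by rewrite -vu; exact: mills_taylor.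
have [x0|x0] := leP 0 x.
  have xh0 : 0 <= x + h by lra.
  have vu : x + h - x = h by ring.
  have [|//|//|] := dist x (x + h); first by rewrite vu gtr0_norm.
  rewrite vu; move=> b1 b2.
  have -> : sign_remainder p h x - h * skew_corr p x =
    (mills (x + h) - mills x - h * mills1 x - h ^+ 2 / 2 * mills2 x) / h + (- p)
        * (x * (mills (x + h) - mills x - h * mills1 x)).
    rewrite /sign_remainder /stein_sign /skew_corr ltNge x0 (ger0_norm x0)
        (ger0_norm xh0) /= /mills2 /mills1.
    by field.
  by apply: bound => //; rewrite normrN ger0_norm.
(* On the negative half-line the same expansions are taken at [- x], with increment [- h]. *)
have {xh} xh : x <= - h by case: xh => //; lra.
have xh0 : x + h <= 0 by lra.
have vu : - (x + h) - (- x) = - h by ring.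
have [||//|] := dist (- x) (- (x + h)).
- by rewrite vu normrN gtr0_norm.
- lra.
- lra.
rewrite vu => b1 b2.
have -> : sign_remainder p h x - h * skew_corr p x =
  (mills (- (x + h)) - mills (- x) - (- h) * mills1 (- x) - h ^+ 2 / 2 * mills2
      (- x)) / h
    + p * (- x * (mills (- (x + h)) - mills (- x) - (- h) * mills1 (- x))).
  rewrite /sign_remainder /stein_sign /skew_corr x0 (ltr0_norm x0) (ler0_norm
      xh0) /= /mills2 /mills1.
  by field.
by apply: bound => //; rewrite ger0_norm.
Qed.

Lemma Phi0 : Phi (0 : R) = 2^-1.
Proof.
rewrite Phi_indic /gauss_mean.
have h1 := itailE 0 cst1_continuous (@bdd_cst1 R).
have h2 := itail_refl 0 cst1_continuous (@bdd_cst1 R).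
rewrite oppr0 in h2; rewrite h2 in h1.
have h3 : itail ((fun=> 1) \o -%R) (0 : R) = itail (fun=> 1) 0 by [].
rewrite h3 in h1 h2; rewrite Rintegral_gauss in h1.
have -> : \int[lebesgue_measure]_x (\1_(`]-oo, (0:R)[) x * gauss x) =
    itail (fun=> 1) (0 : R).
  rewrite -h2 -Rintegral_itv_bndo_bndc; last exact: integrable_gauss1.
  rewrite [RHS]Rintegral_mkcond; apply: eq_Rintegral => x _.
  by rewrite patchE indicE; case: ifP => _; rewrite ?mul1r ?mul0r.
have s0 := @sqrt2pi_gt0 R.
apply: (mulfI (lt0r_neq0 s0)); rewrite mulVKf ?lt0r_neq0//; lra.
Qed.

End sign_expansion.

(** * The deviation at the origin for two-point laws *)

Section two_point_limit.
Context {R : realType}.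
Variable p : R.
Hypothesis p01 : 0 < p < 1.
Let F := two_point p.
Let hF : calF F := two_point_calF p01.
Let Fm : fin_mean F := calF_fin_mean hF.
Let p01' : 0 <= p <= 1. Proof. by case/andP: p01 => *; rewrite !ltW. Qed.

Lemma sign_remainder_mean n (B := Bn F n.+1) :
  \int[law F n.+1]_x sign_remainder p B^-1 (x / B) =
  1 - 2 * fine (law F n.+1 [set s | s / B < 0]).
Proof.
have B0 : 0 < B := Bn_gt0 hF n; have Bn0 : B != 0 by rewrite gt_eqF.
pose f x := stein_sign (x / B).
have mB : measurable_fun setT (fun x : R => x / B) by exact: measurable_funM.
have mf : measurable_fun setT f by apply: measurableT_comp => //;
    exact: measurable_stein_sign.
have bf : bdd_by 2 f by move=> x; exact: stein_sign_bdd.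
have mf1 := shift_measurable 1 mf.
pose A := [set s : R | s / B < 0];
    have mA : measurable A by exact: measurable_standardized.
pose g x := x * (p * f (x + 1) + (1 - p) * f x).
pose d x := f (x + 1) - f x.
have mg : measurable_fun setT g.
  by apply: measurable_funM => //; apply: measurable_funD; apply: measurable_funM.
have md : measurable_fun setT d by apply: measurable_funB.
have ig : (law F n.+1).-integrable setT (EFin \o g).
  apply: (@integrable_growth _ _ _ 2 (law_fin_mean Fm _)) => // x.
  rewrite /g normrM mulrC ler_pM//; last by rewrite lerDr.
  case/andP: p01' => p0 p1.
  rewrite (le_trans (ler_normD _ _))// !normrM (ger0_norm p0) (ger0_norm (_ :
      0 <= 1 - p)) ?subr_ge0//.
  have := bf (x + 1); have := bf x; nra.
have id : (law F n.+1).-integrable setT (EFin \o d).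
  apply: (@integrable_bdd _ _ _ 4) => // x.
  by rewrite /d (le_trans (ler_normB _ _))//; have := bf (x + 1); have := bf x; lra.
have iA : (law F n.+1).-integrable setT (EFin \o (\1_A : R -> R)).
  by apply: (integrable_bdd _ _ (@bdd_indic _ A)); exact: measurable_indic.
have E x : sign_remainder p B^-1 (x / B) =
    (1 - 2 * \1_A x) + (B^-1 * g x - B * d x).
  have -> : \1_A x = (x / B < 0)%R%:R :> R.
    by rewrite indicE; congr ((nat_of_bool _)%:R); rewrite mem_setE.
  rewrite /sign_remainder /g /d /f invrK.
  have -> : x / B + B^-1 = (x + 1) / B by rewrite mulrDl mul1r.
  by field.
rewrite (eq_Rintegral _ (fun x _ => E x)).
have i2A : (law F n.+1).-integrable setT (EFin \o (fun x => 2 * \1_A x : R)).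
  by have := integrableZl measurableT 2 iA; apply: eq_integrable.
have iBg : (law F n.+1).-integrable setT (EFin \o (fun x => B^-1 * g x)).
  by have := integrableZl measurableT B^-1 ig; apply: eq_integrable.
have iBd : (law F n.+1).-integrable setT (EFin \o (fun x => B * d x)).
  by have := integrableZl measurableT B id; apply: eq_integrable.
rewrite RintegralD//; last 2 first.
- by have := integrableB measurableT (prob_integrable_cst (law F n.+1) 1) i2A;
    apply: eq_integrable.
- by have := integrableB measurableT iBg iBd; apply: eq_integrable.
rewrite RintegralB//; last exact: prob_integrable_cst.
rewrite RintegralB// prob_Rintegral_cst !RintegralZl//.
have -> : \int[law F n.+1]_x \1_A x = fine (law F n.+1 A).
  by rewrite /Rintegral integral_indic// setIT.
rewrite (two_point_stein p01 n mf bf) -/(d _) -(two_point_Bn p01) -/F -/B -/(d _).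
have -> : B^-1 * (B ^+ 2 * \int[law F n.+1]_t (f (t + 1) - f t)) =
    B * \int[law F n.+1]_x d x.
  by rewrite /d; field.
by rewrite subrr addr0.
Qed.

(** A rough bound depending on [B]; it only supplies the growth condition of
    [two_point_lattice_le]. *)
Lemma sign_remainder_growth (B : R) : 0 < B -> forall x,
  `|sign_remainder p B^-1 (x / B)| <= (1 + 4 * B + 6 / B) * (1 + `|x|).
Proof.
move=> B0 x; case/andP: p01' => p0 p1.
rewrite /sign_remainder invrK.
set a := stein_sign (x / B); set b := stein_sign (x / B + B^-1).
have a2 : `|a| <= 2 := stein_sign_bdd _; have b2 : `|b| <= 2 := stein_sign_bdd _.
have s1 : `|1 - 2 * (x / B < 0)%R%:R| <= 1 :> R.
  by case: (x / B < 0); rewrite ?mulr1 ?mulr0 ?subr0 ?normr1// ler_norml;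
      apply/andP; split; lra.
have y0 : 0 <= `|x| / B by rewrite divr_ge0// ltW.
have ab : `|b - a| <= 4 by rewrite (le_trans (ler_normB _ _))//; lra.
have s2 : `|x / B * a| <= `|x| / B * 2.
  by rewrite normrM normrM normfV (gtr0_norm B0) ler_wpM2l.
have s3 : `|(b - a) * B| <= 4 * B by rewrite normrM (gtr0_norm B0) ler_wpM2r// ltW.
have s4 : `|p * (x / B) * (b - a)| <= `|x| / B * 4.
  rewrite normrM ler_pM// normrM normrM normfV (gtr0_norm B0) (ger0_norm p0).
  by rewrite ler_piMl.
have t : `|1 - 2 * (x / B < 0)%R%:R + x / B * a - (b - a) * B + p * (x / B) * (b
    - a)| <=
   1 + `|x| / B * 2 + 4 * B + `|x| / B * 4.
  rewrite (le_trans (ler_normD _ _))// lerD// (le_trans (ler_normB _ _))// lerD//.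
  by rewrite (le_trans (ler_normD _ _))// lerD.
apply: (le_trans t).
have q0 : 0 <= 6 / B by rewrite divr_ge0// ltW.
have x0 := normr_ge0 x.
have -> : (1 + 4 * B + 6 / B) * (1 + `|x|) =
    1 + 4 * B + 6 / B + `|x| + 4 * B * `|x| + 6 * (`|x| / B) by ring.
have : 0 <= B * `|x| by rewrite mulr_ge0// ltW.
lra.
Qed.

Lemma two_point_lower n N (B := Bn F n.+1) : n.+1%:R * p = N%:R -> 1 <= B ->
  B^-1 * (\int[law F n.+1]_x skew_corr p (x / B)) - 6 * B^-1 ^+ 2 <=
  1 - 2 * fine (law F n.+1 [set s | s / B < 0]).
Proof.
move=> npN B1; have B0 : 0 < B := Bn_gt0 hF n; have Bn0 : B != 0 by rewrite gt_eqF.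
rewrite -sign_remainder_mean -/B.
have mB : measurable_fun setT (fun x : R => x / B) by exact: measurable_funM.
have mk : measurable_fun setT (fun x : R => skew_corr p (x / B)).
  apply: measurableT_comp => //.
  exact: continuous_measurable_fun (lip_continuous (skew_corr_lip p01')).
have bk : bdd_by 2 (fun x : R => skew_corr p (x / B)) by move=> x;
    exact: skew_corr_bdd.
have ik := integrable_bdd (law F n.+1) mk bk.
have iBk : (law F n.+1).-integrable setT (EFin \o (fun x =>
    B^-1 * skew_corr p (x / B))).
  by have := integrableZl measurableT B^-1 ik; apply: eq_integrable.
rewrite -RintegralZl// -[X in _ - X <= _](prob_Rintegral_cst (law F n.+1)).
rewrite -RintegralB//; last exact: prob_integrable_cst.
have V0 : 0 < B^-1 by rewrite invr_gt0.
have V1 : B^-1 <= 1 by rewrite invf_le1.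
have C0 : 0 <= 6 / B by rewrite divr_ge0// ltW.
apply: (two_point_lattice_le p01 (a := 10 + 4 * B + 6 / B)).
- by apply: measurable_funB => //; exact: measurable_funM.
- have mss := @measurable_stein_sign R.
  have m1 : measurable_fun setT (fun x : R => stein_sign (x / B))
      by exact: measurableT_comp.
  have m2 : measurable_fun setT (fun x : R => stein_sign (x / B + B^-1)).
    by apply: measurableT_comp => //; exact: measurable_funD.
  have m3 : measurable_fun setT (fun x : R => (x / B < 0)%R%:R : R).
    have -> : (fun x : R => (x / B < 0)%R%:R : R) = \1_[set s | s / B < 0].
      by apply/funext => x; rewrite indicE; congr ((nat_of_bool _)%:R);
          rewrite mem_setE.
    by apply: measurable_indic; exact: measurable_standardized.
  rewrite /sign_remainder; apply: measurable_funD.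
    apply: measurable_funB.
      apply: measurable_funD; last exact: measurable_funM.
      by apply: measurable_funB => //; exact: measurable_funM.
    by apply: measurable_funM => //; exact: measurable_funB.
  by apply: measurable_funM; [exact: measurable_funM|exact: measurable_funB].
- move=> x; have := bk x => /= kx.
  have : `|B^-1 * skew_corr p (x / B)| <= 2
      by rewrite normrM (gtr0_norm V0) -[leRHS]mul1r ler_pM// ltW.
  have : 6 * B^-1 ^+ 2 <= 6 by rewrite ler_piMr// exprn_ile1// ltW.
  have : 0 <= 6 * B^-1 ^+ 2 by rewrite mulr_ge0// sqr_ge0.
  move=> h1 h2 h3; rewrite (le_trans (ler_normB _ _))// (ger0_norm h1).
  apply: (@le_trans _ _ (10 + 4 * B + 6 / B)); first lra.
  by rewrite ler_peMr ?lerDl//; lra.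
- move=> x; rewrite (le_trans (sign_remainder_growth B0 x))//
    ler_wpM2r ?addr_ge0//; lra.
- move=> j; rewrite npN; set t := j%:R - N%:R.
  (* Here [t] is an integer since n p is one; a negative value is thus at most -1, and a step of
     length 1/B after scaling does not pass 0. *)
  have xh : 0 <= t / B \/ t / B <= - B^-1.
    have [Nj|jN] := leqP N j.
      by left; rewrite divr_ge0 ?(ltW B0)// subr_ge0 ler_nat.
    right; rewrite -mulN1r ler_wpM2r ?(ltW V0)// lerBlDr -lerBlDl opprK.
    by rewrite natr1 ler_nat.
  have := sign_remainderE p01' (_ : 0 < B^-1 <= 1) xh; rewrite V0 V1 => /(_ isT).
  rewrite ler_norml; lra.
Qed.

Lemma two_point_Delta e : 0 < e -> exists n0, forall n N, (n0 <= n)%N ->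
  n.+1%:R * p = N%:R ->
  (1 + p) / (3 * Num.sqrt (2 * pi)) - e <= Bn F n.+1 * Delta F n.+1.
Proof.
move=> e0.
(* The constant of [clt_lip] for [skew_corr p], bounded by 2 and 4-Lipschitz. The normal
   approximation and the remainder 6/B may each cost [e], as the final inequality is halved. *)
pose c : R := 2 * (12 * 2 + 2 * 4).
have [n0 _ h0] : \forall n \near \oo, stein_rate F (Bn F n.+1) <=
    e / c /\ (Bn F n.+1)^-1 <= Num.min 1 (e / 6).
  have e1 : 0 < e / c by rewrite divr_gt0// /c; lra.
  have e2 : 0 < Num.min 1 (e / 6) by rewrite lt_min ltr01 divr_gt0.
  apply: filterS2 (proj1 (cvgrPdist_le _ _) (stein_rate_cvg hF) _ e1) (proj1
      (cvgrPdist_le _ _) (Bn_inv_cvg hF) _ e2) => n.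
  rewrite !sub0r !normrN => h1 h2; split; first exact: le_trans (ler_norm _) h1.
  exact: le_trans (ler_norm _) h2.
exists n0 => n N n0n npN.
have [] := h0 n n0n; set B := Bn F n.+1 => r1; rewrite le_min => /andP[B1 B6].
have B0 : 0 < B := Bn_gt0 hF n.
have B1' : 1 <= B by rewrite -[B]invrK invf_ge1 ?invr_gt0.
have := two_point_lower npN B1'; rewrite -/B.
have := clt_lip hF n (skew_corr_bdd p01') (skew_corr_lip p01');
    rewrite -/B -/c gauss_mean_skew_corr//.
rewrite ler_norml => /andP[k1 _] l1.
have := cdf_dist_le_Delta hF n 0; rewrite -/B lawSE;
    last exact: measurable_standardized.
rewrite Phi0 ler_norml => /andP[d1 _].
have r2 : c * stein_rate F B <= e by rewrite mulrC -ler_pdivlMr// /c; lra.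
set P := fine _ in l1 d1; set K := \int[_]_x _ in k1 l1.
have l2 : K - 6 * B^-1 <= B * (1 - 2 * P).
  have := ler_wpM2l (ltW B0) l1; congr (_ <= _); field; exact: lt0r_neq0.
have d2 : B * (1 - 2 * P) <= B * (2 * Delta F n.+1)
    by rewrite ler_wpM2l ?(ltW B0)//; lra.
have -> : (1 + p) / (3 * Num.sqrt (2 * pi)) =
    2 * (1 + p) / (3 * Num.sqrt (2 * pi)) / 2.
  by field; exact: lt0r_neq0 sqrt2pi_gt0.
move: k1; set Q := 2 * (1 + p) / _ => k1.
lra.
Qed.

End two_point_limit.

(** * The fractions of two-point laws *)

Section two_point_fractions.
Context {R : realType}.
Variable p : R.
Hypothesis p_range : 2^-1 <= p < 1.
Let p0 : 0 < p. Proof. by case/andP: p_range => + _; apply: lt_le_trans. Qed.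
Let p1 : p < 1. Proof. by case/andP: p_range. Qed.
Let q0 : 0 < 1 - p. Proof. by rewrite subr_gt0; case/andP: p_range. Qed.
Let qp : 1 - p <= p. Proof. by case/andP: p_range => ? _; lra. Qed.
Let p01 : 0 < p < 1. Proof. by rewrite p0. Qed.
Let F := two_point p.
Let hF : calF F := two_point_calF p01.

Lemma two_point_mu1 t : mu1 F t =
  p * ((1 - p) ^+ 3 * (1 - p < t)%R%:R) - (1 - p) * (p ^+ 3 * (p < t)%R%:R).
Proof.
have mA := measurable_abs_lt t.
have mi : measurable_fun setT (\1_[set y | `|y| < t] : R ->
    R) by exact: measurable_indic.
have iE (a : R) : \1_[set y | `|y| < t] a = (`|a| < t)%R%:R :> R.
  by rewrite indicE; congr ((nat_of_bool _)%:R); rewrite mem_setE.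
rewrite mu1E (two_point_Rintegral p01); last by apply: measurable_funM => //;
    exact: measurable_funX.
rewrite !iE normrN (gtr0_norm q0) (gtr0_norm p0).
ring.
Qed.

Lemma two_point_sigma1sqz t : sigma1sqz F t =
  p * ((1 - p) ^+ 2 * (t <= 1 - p)%R%:R) + (1 - p) * (p ^+ 2 * (t <= p)%R%:R).
Proof.
have mA := measurable_abs_ge t.
have mi : measurable_fun setT (\1_[set y | t <= `|y|] : R ->
    R) by exact: measurable_indic.
have iE (a : R) : \1_[set y | t <= `|y|] a = (t <= `|a|)%R%:R :> R.
  by rewrite indicE; congr ((nat_of_bool _)%:R); rewrite mem_setE.
rewrite sigma1sqzE (two_point_Rintegral p01);
    last by apply: measurable_funM => //; exact: measurable_funX.
rewrite !iE normrN (gtr0_norm q0) (gtr0_norm p0).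
ring.
Qed.

Section at_n.
Variable n : nat.
Let B := Bn F n.+1.
Let B0 : 0 < B := Bn_gt0 hF n.
Let Bn0 : B != 0. Proof. by rewrite gt_eqF. Qed.
Let pn0 : p != 0. Proof. by rewrite gt_eqF. Qed.
Let qn0 : 1 - p != 0. Proof. by rewrite gt_eqF. Qed.

Lemma two_point_scale : n.+1%:R = B ^+ 2 / (p * (1 - p)).
Proof. by rewrite (two_point_Bn p01) mulfK// mulf_neq0. Qed.

Lemma two_point_MnE z : Mn F n.+1 z =
  ((1 - p) ^+ 2 * (1 - p < z * B)%R%:R - p ^+ 2 * (p < z * B)%R%:R) / B.
Proof.
rewrite /Mn -/B two_point_scale two_point_mu1.
by field; rewrite Bn0 pn0 qn0.
Qed.

Lemma two_point_LnE z : Ln F n.+1 z =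
  (1 - p) * (z * B <= 1 - p)%R%:R + p * (z * B <= p)%R%:R.
Proof.
rewrite /Ln -/B two_point_scale two_point_sigma1sqz.
by field; rewrite Bn0 pn0 qn0.
Qed.

Lemma g0_ratio z : g0 B (z * B) / g0 B B = Num.min z 1.
Proof. by rewrite /g0 minxx -{2}[B]mul1r -minr_pMl ?ltW// mulfK. Qed.

(** The three entries of the maximum are the three positions of t = zB relative to the atoms. For t
    <= 1-p nothing enters the truncated third moment and the value is t; for 1-p < t <= p only the
    atom 1-p does, giving gam (1-p)^2 + t p; beyond p the term with L_n vanishes and M_n is
    complete. *)
Lemma two_point_LE_le gam z : 0 < gam -> 0 < z ->
  gam * `|Mn F n.+1 z| + z * Ln F n.+1 z <=
  Num.max (1 - p) (Num.max (gam * (1 - p) ^+ 2 + p ^+ 2) (gam * (2 * p - 1))) / B.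
Proof.
move=> gam0 z0; rewrite two_point_MnE two_point_LnE.
rewrite normrM normfV (gtr0_norm B0) ler_pdivlMr// mulrDl.
have -> : gam * (`|(1 - p) ^+ 2 * (1 - p < z * B)%R%:R - p ^+ 2 * (p < z *
    B)%R%:R| / B) * B =
  gam * `|(1 - p) ^+ 2 * (1 - p < z * B)%R%:R - p ^+ 2 * (p < z * B)%R%:R|.
  by rewrite mulrA divfK.
have -> : z * ((1 - p) * (z * B <= 1 - p)%R%:R + p * (z * B <= p)%R%:R) * B =
  (z * B) * ((1 - p) * (z * B <= 1 - p)%R%:R + p * (z * B <= p)%R%:R) by ring.
have t0 : 0 < z * B by rewrite mulr_gt0.
move: (z * B) t0 => t t0; rewrite !le_max.
have [tq|tq] := leP t (1 - p).
  rewrite (le_trans tq qp) ltNge (le_trans tq qp)/= !mulr0 subrr normr0 mulr0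
      add0r !mulr1.
  by rewrite subrK mulr1 tq.
have [tp|tp] := leP t p.
  rewrite /= mulr0 mulr1 subr0 mulr0 add0r mulr1 (ger0_norm (sqr_ge0 _)).
  by apply/orP; right; apply/orP; left; rewrite lerD2l expr2 ler_wpM2r// ltW.
rewrite /= !mulr0 !mulr1 addr0 mulr0 addr0.
apply/orP; right; apply/orP; right; rewrite ler_wpM2l ?(ltW gam0)//.
have -> : (1 - p) ^+ 2 - p ^+ 2 = 1 - 2 * p by ring.
have a := qp; rewrite ler_norml; apply/andP; split; lra.
Qed.

Lemma exists_two_point_Ln e : 0 < e -> exists2 z, 0 < z < e & 0 < Ln F n.+1 z.
Proof.
move=> e0; have [z ze h] := exists_Ln_ge hF n e0; exists z => //.
exact: lt_le_trans h.
Qed.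

(** For g_0 the prefactor is min(z, 1)/z <= 1, so the bound is free of [e]. Positivity is what
    allows it to be inverted in the quotient. *)
Lemma two_point_LE_g0 e gam : 0 < e -> 0 < gam ->
  0 < LE F (@g0 R) e gam n.+1 <=
  Num.max (1 - p) (Num.max (gam * (1 - p) ^+ 2 + p ^+ 2) (gam * (2 * p - 1))) / B.
Proof.
move=> e0 gam0; have [z /andP[z0 ze] hz] := exists_two_point_Ln e0.
have E y : g0 B (y * B) / (y * g0 B B) = Num.min y 1 / y.
  by rewrite invfM [y^-1 * _]mulrC mulrA g0_ratio.
have ub y : 0 < y -> g0 B (y * B) / (y * g0 B B) * (gam * `|Mn F n.+1 y| + y * Ln
    F n.+1 y) <=
    Num.max (1 - p) (Num.max (gam * (1 - p) ^+ 2 + p ^+ 2) (gam * (2 * p - 1))) / B.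
  move=> y0; rewrite E; apply: le_trans (two_point_LE_le gam0 y0).
  rewrite ler_piMl//.
    by rewrite addr_ge0// mulr_ge0 ?Ln_ge0 ?(ltW y0)// ltW.
  by rewrite ler_pdivrMr// mul1r ge_min lexx.
have ne : [set g0 B (z * B) / (z * g0 B B) * (gam * `|Mn F n.+1 z| + z * Ln F
    n.+1 z) | z in `]0, e[] !=set0.
  by eexists; exists z => //=; rewrite in_itv/= z0.
apply/andP; split; last first.
  apply: ge_sup => // w [y]; rewrite /= in_itv/= => /andP[y0 _] <-; exact: ub.
apply: (@lt_le_trans _ _ (g0 B (z * B) / (z * g0 B B) * (gam * `|Mn F n.+1 z| + z
    * Ln F n.+1 z))).
  rewrite E mulr_gt0//.
    by rewrite divr_gt0// lt_min z0 ltr01.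
  by apply: ltr_wpDl; [rewrite mulr_ge0// ltW|exact: mulr_gt0].
apply: ub_le_sup; last by exists z => //=; rewrite in_itv/= z0.
exists (Num.max (1 - p) (Num.max (gam * (1 - p) ^+ 2 + p ^+ 2) (gam * (2 * p -
    1))) / B).
by move=> w [y]; rewrite /= in_itv/= => /andP[y0 _] <-; exact: ub.
Qed.

(** Once [p < e * B] both atoms lie below the truncation level, so M_n(e) is the full (1 - 2p)/B. In
    the supremum z L_n(z) is at most (1-p)/B up to the first atom and p^2/B up to the second. *)
Lemma two_point_LR_g0 e gam : 0 < e -> 0 < gam -> p < e * B ->
  0 < LR F (@g0 R) e gam n.+1 <=
  (gam * Num.min e^-1 1 * (2 * p - 1) + Num.max (1 - p) (p ^+ 2)) / B.
Proof.
move=> e0 gam0 peB; have [z /andP[z0 ze] hz] := exists_two_point_Ln e0.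
have ub y : 0 < y -> g0 B (y * B) / g0 B B * Ln F n.+1 y <=
    Num.max (1 - p) (p ^+ 2) / B.
  move=> y0; rewrite g0_ratio.
  apply: (@le_trans _ _ (y * Ln F n.+1 y)).
    by rewrite ler_wpM2r ?Ln_ge0// ge_min lexx.
  rewrite two_point_LnE ler_pdivlMr// mulrAC.
  have t0 : 0 < y * B by rewrite mulr_gt0.
  move: (y * B) t0 => t t0; rewrite le_max.
  have [tq|tq] := leP t (1 - p).
    by rewrite (le_trans tq qp)/= !mulr1 subrK mulr1 tq.
  have [tp|tp] := leP t p.
    by rewrite mulr0 add0r mulr1 expr2 ler_wpM2r ?(ltW p0)// orbT.
  by rewrite !mulr0 addr0 mulr0 (ltW q0).
have ne : [set g0 B (z * B) / g0 B B * Ln F n.+1 z | z in `]0, e[] !=set0.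
  by eexists; exists z => //=; rewrite in_itv/= z0.
have rE : g0 B (e * B) / (e * g0 B B) = Num.min e^-1 1.
  rewrite invfM [e^-1 * _]mulrC mulrA g0_ratio minr_pMl ?invr_ge0 ?(ltW e0)//.
  by rewrite divff ?gt_eqF// mul1r minC.
have m0 : 0 < Num.min e^-1 1 by rewrite lt_min ltr01 invr_gt0 e0.
have M0 : 0 <= gam * (g0 B (e * B) / (e * g0 B B)) * `|Mn F n.+1 e|.
  by rewrite rE !mulr_ge0// ltW.
apply/andP; split; rewrite /LR -/B.
  apply: (@lt_le_trans _ _ (0 + g0 B (z * B) / g0 B B * Ln F n.+1 z)).
    by rewrite add0r g0_ratio mulr_gt0// lt_min z0 ltr01.
  rewrite lerD//; apply: ub_le_sup; last by exists z => //=; rewrite in_itv/= z0.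
  exists (Num.max (1 - p) (p ^+ 2) / B).
  by move=> w [y]; rewrite /= in_itv/= => /andP[y0 _] <-; exact: ub.
rewrite mulrDl lerD//; last first.
  apply: ge_sup => // w [y]; rewrite /= in_itv/= => /andP[y0 _] <-; exact: ub.
rewrite rE two_point_MnE -[leRHS]mulrA ler_wpM2l//; first by rewrite mulr_ge0// ltW.
rewrite peB (le_lt_trans qp peB) !mulr1 normrM normfV (gtr0_norm B0).
rewrite ler_wpM2r ?invr_ge0 ?(ltW B0)//.
have -> : (1 - p) ^+ 2 - p ^+ 2 = 1 - 2 * p by ring.
have a := qp; rewrite ler_norml; apply/andP; split; lra.
Qed.

End at_n.

Lemma limn_esup_ge (u : nat -> R) c :
  (forall e n0, 0 < e -> exists2 n, (n0 <= n)%N & c - e <= u n) ->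
  (c%:E <= limn_esup (fun n => (u n)%:E))%E.
Proof.
move=> h; apply: le_ereal_inf_tmp => _ [V [n0 _ nV] <-].
apply/lee_addgt0Pr => e e0; have [n n0n cn] := h e n0 e0.
rewrite -leeBlDr//; apply: le_ereal_sup_tmp; exists (u n)%:E;
    last by rewrite -EFinB lee_fin.
by exists n => //; exact: nV.
Qed.

Lemma two_point_limn_esup (L : nat -> R) D a b : 0 < D -> (0 < b)%N ->
    p = a%:R / b%:R ->
  (exists n0, forall n, (n0 <= n)%N -> 0 < L n.+1 <= D / Bn F n.+1) ->
  (((1 + p) / (3 * Num.sqrt (2 * pi)) / D)%:E <= limn_esup (fun n =>
      (Delta F n / L n)%:E))%E.
Proof.
move=> D0 b0 pab [n1 L1]; apply: limn_esup_ge => e m e0.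
have [n0 h0] := two_point_Delta p01 (mulr_gt0 e0 D0).
(* Indices [n.+1] that are multiples of the denominator [b] make n p integral; [k] exceeds all
   thresholds at once. *)
pose k := (n0 + n1 + m)%N; pose n := (b * k.+1).-1.
have nE : n.+1 = (b * k.+1)%N by rewrite /n prednK// muln_gt0 b0.
have kn : (k <= n)%N by rewrite -ltnS nE (leq_trans _ (leq_pmull _ b0)).
have npN : n.+1%:R * p = (a * k.+1)%N%:R.
  rewrite nE pab !natrM mulrAC mulrCA mulfV ?pnatr_eq0 ?gt_eqF//.
  by rewrite mulr1 mulrC.
exists n.+1; first by rewrite (leq_trans _ (leqW kn))// leq_addl.
have hD := h0 n _ (leq_trans (leq_trans (leq_addr n1 n0) (leq_addr m _)) kn) npN.
have /andP[L0 LD] := L1 n (leq_trans (leq_trans (leq_addl n0 n1) (leq_addr m _))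
    kn).
have B0 : 0 < Bn F n.+1 := Bn_gt0 hF n.
have d0 := Delta_ge0 hF n.
apply: (@le_trans _ _ (Bn F n.+1 * Delta F n.+1 / D)).
  by rewrite ler_pdivlMr// mulrBl divfK ?gt_eqF.
rewrite [_ * Delta F _]mulrC -mulrA ler_wpM2l//.
by rewrite -[_ / D]invrK invf_div lef_pV2 ?posrE ?divr_gt0.
Qed.

Lemma CAB_E_g0_ge e gam a b : 0 < e -> 0 < gam -> (0 < b)%N -> p = a%:R / b%:R ->
  (((1 + p) / (3 * Num.sqrt (2 * pi)) /
    Num.max (1 - p) (Num.max (gam * (1 - p) ^+ 2 + p ^+ 2) (gam * (2 * p - 1))))%:E
   <= CAB_E (@g0 R) e gam)%E.
Proof.
move=> e0 gam0 b0 pab; apply: le_ereal_sup_tmp.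
exists (limn_esup (fun n => (Delta F n / LE F (@g0 R) e gam n)%:E));
    first by exists F.
apply: (two_point_limn_esup _ b0 pab); first by rewrite lt_max q0.
by exists 0%N => n _; exact: two_point_LE_g0.
Qed.

Lemma CAB_R_g0_ge e gam a b : 0 < e -> 0 < gam -> (0 < b)%N -> p = a%:R / b%:R ->
  (((1 + p) / (3 * Num.sqrt (2 * pi)) /
    (gam * Num.min e^-1 1 * (2 * p - 1) + Num.max (1 - p) (p ^+ 2)))%:E
   <= CAB_R (@g0 R) e gam)%E.
Proof.
move=> e0 gam0 b0 pab; apply: le_ereal_sup_tmp.
exists (limn_esup (fun n => (Delta F n / LR F (@g0 R) e gam n)%:E));
    first by exists F.
apply: (two_point_limn_esup _ b0 pab).
  apply: ltr_wpDl; last by rewrite lt_max q0.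
  rewrite !mulr_ge0 ?(ltW gam0)//.
    by rewrite le_min ler01 invr_ge0 ltW.
  by case/andP: p_range => ? _; lra.
have pe : 0 < e / p by rewrite divr_gt0.
have [n0 _ h0] := proj1 (cvgrPdist_lt _ _) (Bn_inv_cvg hF) _ pe.
exists n0 => n n0n; apply: two_point_LR_g0 => //.
have B0 : 0 < Bn F n.+1 := Bn_gt0 hF n.
have := h0 n n0n; rewrite /= sub0r normrN gtr0_norm ?invr_gt0//.
by rewrite ltr_pdivlMr// ltr_pdivrMl// mulrC.
Qed.

End two_point_fractions.

(** * Passage from rational to real parameters *)

Section rational_limit.
Context {R : realType}.

Lemma ratr_nat_div (q : rat) : 0 < (ratr q : R) -> exists a b : nat,
  (0 < b)%N /\ ratr q = a%:R / b%:R :> R.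
Proof.
rewrite ltr0q => q0; exists `|numq q|%N, `|denq q|%N.
rewrite absz_gt0 denq_neq0; split=> //.
have hn : (`|numq q|%N%:R : R) = (numq q)%:~R.
  by rewrite -[in RHS](gtz0_abs (_ : 0 < numq q)) ?numq_gt0// -pmulrn.
have hd : (`|denq q|%N%:R : R) = (denq q)%:~R.
  by rewrite -[in RHS](gtz0_abs (denq_gt0 q)) -pmulrn.
by rewrite hn hd.
Qed.

Lemma le_rational_limit (c : R -> R) (x : \bar R) (p : R) : 2^-1 < p < 1 ->
  {for p, continuous c} ->
  (forall (r : R) (a b : nat), 2^-1 <= r < 1 -> (0 < b)%N -> r = a%:R / b%:R ->
      ((c r)%:E <= x)%E) ->
  ((c p)%:E <= x)%E.
Proof.
move=> /andP[p0 p1] cp h; apply/lee_addgt0Pr => e e0.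
have /cvgrPdist_lt/(_ e e0) := cp.
move=> /nbhs_ballP[d /= d0 hd].
have [|q] := @rat_in_itvoo R p (Num.min 1 (p + d)).
  by rewrite lt_min p1 ltrDl.
rewrite in_itv/= lt_min => /and3P[pq q1 qd].
have q0 : 0 < (ratr q : R) by rewrite (lt_trans _ pq)// (lt_trans _ p0).
have [a [b [b0 qab]]] := ratr_nat_div q0.
have cq : ((c (ratr q))%:E <= x)%E.
  by apply: (h _ a b) => //; rewrite q1 (ltW (lt_trans p0 pq)).
apply: (@le_trans _ _ ((c (ratr q))%:E + e%:E)%E); last exact: leeD.
rewrite -EFinD lee_fin.
have : ball p d (ratr q) by rewrite /ball/= ltr0_norm ?subr_lt0// opprB ltrBlDl.
by move=> /hd; rewrite ltr_distlC => /andP[/ltW + _]; rewrite lerBlDr.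
Qed.

Lemma cvg_maxr (f g : R -> R) (a b p : R) : f x @[x --> p] --> a ->
    g x @[x --> p] --> b ->
  Num.max (f x) (g x) @[x --> p] --> Num.max a b.
Proof.
move=> fa gb; rewrite Num.Theory.maxr_absE.
have -> : (fun x => Num.max (f x) (g x)) = (fun x =>
    (f x + g x + `|f x - g x|) / 2).
  by apply/funext => x; rewrite Num.Theory.maxr_absE.
apply: cvgM; last exact: cvg_cst.
apply: cvgD; first exact: cvgD.
by apply: cvg_norm; exact: cvgB.
Qed.

End rational_limit.

(** * Optimisation over the two-point laws *)

Section final_bounds.
Context {R : realType}.

Definition E_value (gam p : R) : R := (1 + p) / (3 * Num.sqrt (2 * pi)) /
  Num.max (1 - p) (Num.max (gam * (1 - p) ^+ 2 + p ^+ 2) (gam * (2 * p - 1))).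

Definition R_value (m p : R) : R := (1 + p) / (3 * Num.sqrt (2 * pi)) /
  (m * (2 * p - 1) + Num.max (1 - p) (p ^+ 2)).

Lemma continuous_onem (p : R) : {for p, continuous (fun x : R => 1 - x)}.
Proof. by apply: cvgB; [exact: cvg_cst|exact: cvg_id]. Qed.

Lemma continuous_double_sub1 (m p : R) : {for p, continuous (fun x : R =>
    m * (2 * x - 1))}.
Proof.
apply: cvgM; first exact: cvg_cst.
by apply: cvgB; [apply: cvgM; [exact: cvg_cst|exact: cvg_id]|exact: cvg_cst].
Qed.

Lemma continuous_sqr (p : R) : {for p, continuous (fun x : R => x ^+ 2)}.
Proof. exact: exprn_continuous. Qed.

Lemma continuous_onem_sqr (p : R) : {for p, continuous (fun x : R => (1 - x) ^+ 2)}.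
Proof. exact: (continuous_comp (@continuous_onem p) (@continuous_sqr (1 - p))). Qed.

Lemma continuous_numerator (p : R) :
  {for p, continuous (fun x : R => (1 + x) / (3 * Num.sqrt (2 * pi)))}.
Proof.
apply: cvgM; last exact: cvg_cst.
by apply: cvgD; [exact: cvg_cst|exact: cvg_id].
Qed.

Lemma continuous_E_value (gam p : R) : p < 1 -> {for p, continuous (E_value gam)}.
Proof.
move=> p1; apply: cvgM; first exact: continuous_numerator.
apply: cvgV; first by rewrite gt_eqF// lt_max subr_gt0 p1.
apply: cvg_maxr; first exact: continuous_onem.
apply: cvg_maxr; last exact: continuous_double_sub1.
apply: cvgD; last exact: continuous_sqr.
apply: cvgM; first exact: cvg_cst.
exact: continuous_onem_sqr.
Qed.

Lemma continuous_R_value (m p : R) : 0 <= m -> 2^-1 <= p < 1 ->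
    {for p, continuous (R_value m)}.
Proof.
move=> m0 /andP[ph p1]; apply: cvgM; first exact: continuous_numerator.
apply: cvgV.
  rewrite gt_eqF// ltr_wpDl ?lt_max ?subr_gt0 ?p1// mulr_ge0//; lra.
apply: cvgD; first exact: continuous_double_sub1.
by apply: cvg_maxr; [exact: continuous_onem|exact: continuous_sqr].
Qed.

Lemma CAB_E_ge (e gam p : R) : 0 < e -> 0 < gam -> 2^-1 < p < 1 ->
  ((E_value gam p)%:E <= CAB_E (@g0 R) e gam)%E.
Proof.
move=> e0 gam0 p01; apply: (le_rational_limit p01).
  by apply: continuous_E_value; case/andP: p01.
by move=> r a b r01 b0 rab; exact: (CAB_E_g0_ge r01 e0 gam0 b0 rab).
Qed.

Lemma CAB_R_ge (e gam p : R) : 0 < e -> 0 < gam -> 2^-1 < p < 1 ->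
  ((R_value (gam * Num.min e^-1 1) p)%:E <= CAB_R (@g0 R) e gam)%E.
Proof.
move=> e0 gam0 p01; have /andP[ph p1] := p01; apply: (le_rational_limit p01).
  apply: continuous_R_value; last by rewrite p1 ltW.
  by rewrite mulr_ge0 ?(ltW gam0)// le_min ler01 invr_ge0 ltW.
by move=> r a b r01 b0 rab; exact: (CAB_R_g0_ge r01 e0 gam0 b0 rab).
Qed.

Lemma CAB_E_sup_ge (e gam : R) : 0 < e -> 0 < gam ->
  (((3 * Num.sqrt (2 * pi))^-1 *
        sup [set (p + 1) / Num.max (1 - p)
                   (Num.max (gam * (1 - p) ^+ 2 + p ^+ 2) (gam * (2 * p - 1)))
            | p in `]2^-1, 1[])%:E <= CAB_E (@g0 R) e gam)%E.
Proof.
move=> e0 gam0.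
have s0 : 0 < 3 * Num.sqrt (2 * pi) :> R by rewrite mulr_gt0// sqrt2pi_gt0.
have h p : 2^-1 < p < 1 -> ((E_value gam p)%:E <= CAB_E (@g0 R) e gam)%E
    by exact: CAB_E_ge.
have h34 : 2^-1 < (3 / 4 : R) < 1 by apply/andP; split; lra.
(* A finite constant is itself an upper bound of the set, which makes the real [sup] meaningful; the
   value -oo is excluded by the point p = 3/4. *)
case: (CAB_E _ _ _) h => [r|_|/(_ _ h34)]; last by rewrite leeNy_eq.
- move=> h; rewrite lee_fin ler_pdivrMl//; apply: ge_sup.
    by eexists; exists (3 / 4) => //=; rewrite in_itv.
  move=> w [p]; rewrite /= in_itv/= => /h; rewrite lee_fin => hp <-.
  rewrite -ler_pdivrMl//; apply: le_trans hp.
  by rewrite /E_value [1 + p]addrC mulrA [_^-1 * _]mulrC.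
- by rewrite leey.
Qed.

Lemma sqrt_itv (x a b : R) : 0 <= a -> 0 < b -> a ^+ 2 < x -> x < b ^+ 2 ->
  a < Num.sqrt x /\ Num.sqrt x < b.
Proof.
move=> a0 b0 ax xb; split.
- by rewrite -[a]ger0_norm// -sqrtr_sqr ltr_sqrt// (le_lt_trans _ ax)// sqr_ge0.
- by rewrite -[b]gtr0_norm// -sqrtr_sqr ltr_sqrt// exprn_gt0.
Qed.

(* The maximiser for [gam = 1] is the positive root of [2 p^2 + 4 p - 3]. *)
Lemma E_value_opt : E_value 1 ((Num.sqrt 10 - 2) / 2 : R) =
  (Num.sqrt 10 + 3) / (6 * Num.sqrt (2 * pi)).
Proof.
(* With r = sqrt 10 the entries of the maximum are 2 - r/2, 10 - 3r and r - 3; the first two meet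
   exactly at r = 16/5, below which the middle one dominates. *)
have [ra rb] : (3 : R) < Num.sqrt 10 /\ Num.sqrt 10 < (16 / 5 : R).
    by apply: sqrt_itv; lra.
have r2 : Num.sqrt 10 ^+ 2 = 10 :> R by rewrite sqr_sqrtr.
rewrite /E_value; move: (Num.sqrt 10) r2 ra rb => r r2 ra rb.
have -> : 1 * (1 - (r - 2) / 2) ^+ 2 + ((r - 2) / 2) ^+ 2 = 10 - 3 * r.
  have -> : 1 * (1 - (r - 2) / 2) ^+ 2 + ((r - 2) / 2) ^+ 2 =
      r ^+ 2 / 2 - 3 * r + 5 by field.
  by rewrite r2; field.
rewrite [Num.max (10 - _) _]max_l; last lra.
rewrite max_r; last lra.
have s0 : Num.sqrt (2 * pi) != 0 :> R by rewrite gt_eqF// sqrt2pi_gt0.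
have d0 : 10 - 3 * r != 0 by rewrite gt_eqF//; lra.
apply/eqP; rewrite -subr_eq0; apply/eqP.
have -> : (1 + (r - 2) / 2) / (3 * Num.sqrt (2 * pi)) / (10 - 3 * r) - (r + 3) /
    (6 * Num.sqrt (2 * pi)) =
  3 * (r ^+ 2 - 10) / (6 * Num.sqrt (2 * pi) * (10 - 3 * r)).
  by field; rewrite s0 d0.
by rewrite r2 subrr mulr0 mul0r.
Qed.

(* At this point [p^2 = 1 - p], so the two branches of the maximum coincide. *)
Lemma R_value_opt (m : R) : 0 <= m -> R_value m ((Num.sqrt 5 - 1) / 2) =
  (1 + Num.sqrt 5) / (3 * Num.sqrt (2 * pi) * (2 * m * (Num.sqrt 5 - 2) + 3 -
      Num.sqrt 5)).
Proof.
move=> m0.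
have [ra rb] : (2 : R) < Num.sqrt 5 /\ Num.sqrt 5 < (3 : R).
    by apply: sqrt_itv; lra.
have r2 : Num.sqrt 5 ^+ 2 = 5 :> R by rewrite sqr_sqrtr.
rewrite /R_value; move: (Num.sqrt 5) r2 ra rb => r r2 ra rb.
have -> : ((r - 1) / 2) ^+ 2 = 1 - (r - 1) / 2.
  have -> : ((r - 1) / 2) ^+ 2 = r ^+ 2 / 4 - r / 2 + 1 / 4 by field.
  by rewrite r2; field.
rewrite maxxx.
have s0 : Num.sqrt (2 * pi) != 0 :> R by rewrite gt_eqF// sqrt2pi_gt0.
have mr : 0 <= m * (r - 2) by rewrite mulr_ge0//; lra.
have d0 : 2 * m * (r - 2) + 3 - r != 0 by rewrite gt_eqF//; lra.
have d1 : m * (2 * ((r - 1) / 2) - 1) + (1 - (r - 1) / 2) =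
    (2 * m * (r - 2) + 3 - r) / 2 by field.
by rewrite d1; field; rewrite s0 d0.
Qed.

Lemma CAB_g1_eq0 (L : probability R R -> nat -> R) :
  (forall F n, calF F -> 2^-1 <= L F n.+1) ->
  ereal_sup [set limn_esup (fun n => (Delta F n / L F n)%:E) | F in @calF R] = 0%E.
Proof.
move=> hL; rewrite (_ : [set _ | F in _] = [set 0%E]) ?ereal_sup1//.
have h F : calF F -> limn_esup (fun n => (Delta F n / L F n)%:E) = 0%E.
  by move=> hF; apply: limn_esup_ratio0 => // n; exact: hL.
apply/seteqP; split => [_ [F hF <-]|_ ->] /=; first exact: h.
(* A symmetric two-point law shows that the class is nonempty; an empty supremum would be -oo. *)
have p01 : 0 < (2^-1 : R) < 1 by apply/andP; split; lra.
by exists (two_point 2^-1); [exact: two_point_calF|exact/h/two_point_calF].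
Qed.

End final_bounds.

Theorem theorem5 (R : realType) (eps gam : R) :
  0 < eps -> 0 < gam ->
  [/\ (* (i) *)
      (((3 * Num.sqrt (2 * pi))^-1 *
        sup [set (p + 1) / Num.max (1 - p)
                   (Num.max (gam * (1 - p) ^+ 2 + p ^+ 2) (gam * (2 * p - 1)))
            | p in `]2^-1, 1[])%:E
        <= ereal_inf [set CAB_E (@g0 R) e gam | e in [set e : R | (0 < e)%R]])%E,
      (* (i), particular case gamma = 1 *)
      (((Num.sqrt 10 + 3) / (6 * Num.sqrt (2 * pi)))%:E
        <= ereal_inf [set CAB_E (@g0 R) e 1 | e in [set e : R | (0 < e)%R]])%E,
      (* (ii) *)
      ((if gam / Num.max eps 1 < 2 / 3
        then (1 + Num.sqrt 5) /
             (3 * Num.sqrt (2 * pi) *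
              (2 * gam * Num.min eps^-1 1 * (Num.sqrt 5 - 2) + 3 - Num.sqrt 5))
        else (Num.sqrt (2 * pi))^-1)%:E
        <= CAB_R (@g0 R) eps gam)%E,
      (* (iii) *)
      CAB_E (@g1 R) eps gam = 0%E &
      CAB_R (@g1 R) eps gam = 0%E].
Proof.
move=> eps0 gam0; split.
- by apply: le_ereal_inf_tmp => _ [e /= e0 <-]; exact: CAB_E_sup_ge.
- apply: le_ereal_inf_tmp => _ [e /= e0 <-]; rewrite -E_value_opt.
  apply: CAB_E_ge => //.
  have [ra rb] : (3 : R) < Num.sqrt 10 /\ Num.sqrt 10 < (16 / 5 : R).
    by apply: sqrt_itv; lra.
  by apply/andP; split; lra.
(* The threshold 2/3 is the value of m = gam min(1/eps, 1) at which the bound from p = (sqrt 5 -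
   1)/2 equals 1/sqrt(2 pi). *)
- case: ifP => _.
    have m0 : 0 <= gam * Num.min eps^-1 1.
      by rewrite mulr_ge0 ?(ltW gam0)// le_min ler01 invr_ge0 ltW.
    rewrite -[2 * gam * _]mulrA -R_value_opt//; apply: CAB_R_ge => //.
    have [ra rb] : (2 : R) < Num.sqrt 5 /\ Num.sqrt 5 < (3 : R).
    by apply: sqrt_itv; lra.
    by apply/andP; split; lra.
  (* The symmetric law p = 1/2 has no third moment, so [gam] disappears. Being rational, this
     endpoint is used directly, without a limit in p. *)
  have p01 : 2^-1 <= (2^-1 : R) < 1 by rewrite lexx/=; lra.
  have h2 : 2^-1 = 1%:R / 2%:R :> R by rewrite mul1r.
  have := CAB_R_g0_ge p01 eps0 gam0 (isT : (0 < 2)%N) h2.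
  congr (_%:E <= _)%E.
  have -> : 2 * 2^-1 - 1 = 0 :> R by rewrite divff ?subrr.
  rewrite mulr0 add0r max_l; last by rewrite expr2; lra.
  by field; rewrite gt_eqF// sqrt2pi_gt0.
- by apply: CAB_g1_eq0 => F n hF; exact: LE_g1_ge.
- by apply: CAB_g1_eq0 => F n hF; exact: LR_g1_ge.
Qed.
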